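(* Let $K, L, M$ be three full-rank lattices in $\mathbb{R}^d$ of equal volume such that $K+L+M$ is a full-rank lattice. Let $H = K\cap L\cap M$, and let $X := K/H$, $Y := L/H$, $Z := M/H$, regarded as subgroups of $G := (K+L+M)/H$. Then $K, L, M$ do not share a common fundamental domain in $\mathbb{R}^d$ if and only if the Sylow $2$-subgroups $X_2, Y_2, Z_2$ of $X, Y, Z$ are non-trivial cyclic, pairwise disjoint (i.e. any two of them intersect only in the zero element), and satisfy \[ G_2 = X_2 \oplus Y_2 = X_2 \oplus Z_2 = Y_2 \oplus Z_2 . \]
   Context: A full-rank lattice in $\mathbb{R}^d$ is a subgroup of the form $A\mathbb{Z}^d$ with $A$ an invertible real $d\times d$ matrix; its volume is $|\det A|$. A fundamental domain (transversal) of a full-rank lattice $L$ in $\mathbb{R}^d$ is a subset of $\mathbb{R}^d$ containing exactly one representative of each coset of $L$ in $\mathbb{R}^d$ (no measurability or boundedness is required). A common fundamental domain of $K, L, M$ is a set that is a fundamental domain of each of them. Under the hypotheses, $H$ is also a full-rank lattice, so $G$ is a finite abelian group. For a finite abelian group $W$, $W_2$ denotes its unique Sylow $2$-subgroup; $\oplus$ denotes the internal direct sum of subgroups of $G$. *)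

(* Defs.v *)
From HB Require Import structures.
From mathcomp Require Import all_boot all_order all_algebra all_fingroup.
From mathcomp Require Import all_solvable ring_quotient.
From mathcomp Require Import boolp classical_sets reals.

Set Implicit Arguments.
Unset Strict Implicit.
Unset Printing Implicit Defensive.

Import Order.TTheory GRing.Theory Num.Theory.
Local Open Scope ring_scope.
Local Open Scope quotient_scope.

Record lattice (R : realType) (d : nat) := Lattice {
  lattice_basis : 'M[R]_d;
  lattice_basis_unit : lattice_basis \in unitmx }.

Section Lattices.
Variables (R : realType) (d : nat).
Implicit Types K L M N : lattice R d.

Definition lattice_points K : {pred 'cV[R]_d} :=
  [pred v | `[< exists z : 'cV[int]_d, v = lattice_basis K *m map_mx intr z >]].

Coercion lattice_points : lattice >-> pred_sort.

Definition volume K : R := `|\det (lattice_basis K)|.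

Definition fundamental_domain K (F : set 'cV[R]_d) : Prop :=
  forall v : 'cV[R]_d, exists! f, F f /\ v - f \in K.

Definition lattice_sum3 K L M : {pred 'cV[R]_d} :=
  [pred v | `[< exists a b c,
    [/\ a \in K, b \in L, c \in M & v = a + b + c] >]].

Definition lattice_cap3 K L M : {pred 'cV[R]_d} :=
  [pred v | [&& v \in K, v \in L & v \in M]].

Definition is_lattice (S : {pred 'cV[R]_d}) : Prop :=
  exists N, S =i N.

Fact lattice_zmod_closed K : zmod_closed (lattice_points K).
Proof.
split=> [|u v /asboolP[x ->] /asboolP[y ->]]; apply/asboolP.
  by exists 0; rewrite map_mx0 mulmx0.
by exists (x - y); rewrite map_mxB mulmxBr.
Qed.

HB.instance Definition _ K :=
  GRing.isZmodClosed.Build _ (lattice_points K) (lattice_zmod_closed K).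

Fact lattice_sum3_zmod_closed K L M : zmod_closed (lattice_sum3 K L M).
Proof.
split=> [|u v /asboolP[a [b [c [aK bL cM ->]]]]].
  apply/asboolP; exists 0, 0, 0; split; try exact: rpred0.
  by rewrite !addr0.
move=> /asboolP[a' [b' [c' [a'K b'L c'M ->]]]].
apply/asboolP; exists (a - a'), (b - b'), (c - c').
split; try exact: rpredB.
by rewrite [in LHS]opprD [in LHS]opprD addrACA; congr (_ + _); rewrite addrACA.
Qed.

HB.instance Definition _ K L M := GRing.isZmodClosed.Build _
  (lattice_sum3 K L M) (lattice_sum3_zmod_closed K L M).

Record sum3_type K L M := Sum3 {
  sum3_val : 'cV[R]_d;
  _ : sum3_val \in lattice_sum3 K L M }.

HB.instance Definition _ K L M := [isSub for @sum3_val K L M].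
HB.instance Definition _ K L M := [Choice of sum3_type K L M by <:].
HB.instance Definition _ K L M :=
  [SubChoice_isSubZmodule of sum3_type K L M by <:].

(* [lattice_cap3 K L M], viewed inside K + L + M. *)
Definition cap3_in_sum3 K L M : {pred sum3_type K L M} :=
  [pred u | val u \in lattice_cap3 K L M].

Fact cap3_in_sum3_zmod_closed K L M : zmod_closed (@cap3_in_sum3 K L M).
Proof.
split=> [|u v /and3P[uK uL uM] /and3P[vK vL vM]]; apply/and3P; split=> /=;
  do ?[exact: rpred0 | exact: rpredB].
Qed.

HB.instance Definition _ K L M := GRing.isZmodClosed.Build _
  (@cap3_in_sum3 K L M) (cap3_in_sum3_zmod_closed K L M).

(* (K + L + M) / (K :&: L :&: M). The argument [h] does not occur in the body:
   it makes the quotient finite, which the finType instance below needs. *)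
Definition sum3_mod_cap3 K L M (h : is_lattice (lattice_sum3 K L M)) : Type :=
  {ideal_quot (@cap3_in_sum3 K L M)}.

HB.instance Definition _ K L M h := ZmodQuotient.on (@sum3_mod_cap3 K L M h).

Fact lattice_multiple K N : {subset K <= N} ->
  exists2 m : nat, (0 < m)%N & forall v, v \in N -> v *+ m \in K.
Proof.
move=> sKN; set A := lattice_basis K; set P := lattice_basis N.
have colA j : exists z : 'cV[int]_d, col j A = P *m map_mx intr z.
  apply/asboolP/sKN/asboolP; exists (delta_mx j 0).
  by rewrite -/A map_delta_mx colE.
have [U defA] : exists U : 'M[int]_d, A = P *m map_mx intr U.
  have [z Ez] := choice colA.
  exists (\matrix_(i, j) z j i 0); apply/matrixP=> i j.
  have /matrixP/(_ i 0) := Ez j; rewrite !mxE => ->.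
  by apply: eq_bigr => k _; rewrite !mxE.
have U_neq0 : \det U != 0.
  have := lattice_basis_unit K; rewrite -/A defA unitmxE unitfE det_mulmx.
  by rewrite mulf_eq0 negb_or det_map_mx intr_eq0 => /andP[].
exists `|\det U|%N; first by rewrite absz_gt0.
move=> _ /asboolP[z ->]; rewrite -/P.
suff detK : (P *m map_mx intr z) *~ \det U \in K.
  case: (intP (\det U)) detK => // n; rewrite ?abszN //.
  by rewrite mulrNz rpredN.
apply/asboolP; exists (\adj U *m z); rewrite -/A defA map_mxM mulmxA.
rewrite -(mulmxA P) -map_mxM mul_mx_adj map_scalar_mx -scaler_int.
by rewrite -mulmxA mul_scalar_mx -scalemxAr.
Qed.

Fact sum3_mod_cap3_finite K L M (h : is_lattice (lattice_sum3 K L M)) :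
  exists s : seq (sum3_mod_cap3 h), forall x, x \in s.
Proof.
have [N SN] := h; set P := lattice_basis N.
have sKN : {subset K <= N}.
  move=> v vK; rewrite -SN; apply/asboolP; exists v, 0, 0.
  by rewrite !rpred0 !addr0.
have sLN : {subset L <= N}.
  move=> v vK; rewrite -SN; apply/asboolP; exists 0, v, 0.
  by rewrite !rpred0 add0r addr0.
have sMN : {subset M <= N}.
  move=> v vK; rewrite -SN; apply/asboolP; exists 0, 0, v.
  by rewrite !rpred0 !add0r.
have [[[k k0 kK] [l l0 lL]] [m m0 mM]] :=
  (lattice_multiple sKN, lattice_multiple sLN, lattice_multiple sMN).
have n0 : (0 < k * l * m)%N by rewrite !muln_gt0 k0 l0.
have nH v : v \in N -> v *+ (k * l * m) \in lattice_cap3 K L M.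
  move=> vN; apply/and3P; split; last by rewrite mulnC mulrnA rpredMn ?mM.
    by rewrite -mulnA mulrnA rpredMn ?kK.
  by rewrite mulnAC mulnC mulrnA rpredMn ?lL.
move: (k * l * m)%N n0 nH => n n0 nH {k k0 kK l l0 lL m m0 mM}.
pose pt (z : 'cV[int]_d) : sum3_type K L M := insubd 0 (P *m map_mx intr z).
have ptE z : val (pt z) = P *m map_mx intr z.
  by rewrite insubdK //; change (P *m map_mx intr z \in lattice_sum3 K L M);
     rewrite SN; apply/asboolP; exists z.
pose r (t : 'cV['I_n]_d) : sum3_mod_cap3 h :=
  \pi_(sum3_mod_cap3 h) (pt (map_mx (fun i : 'I_n => (i : nat)%:Z) t)).
exists (codom r) => x; rewrite -[x]reprK; move: (generic_quotient.repr x) => u {x}.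
have /asboolP[z uE] : val u \in N by rewrite -SN; exact: valP.
pose t := map_mx (fun a : int => Ordinal (ltn_pmod `|(a %% n)%Z| n0)) z.
apply/codomP; exists t; apply/eqP; rewrite -Quotient.idealrBE.
set w := pt _; change (val (u - w) \in lattice_cap3 K L M).
suff -> : val (u - w) =
    (P *m map_mx intr (map_mx (fun a => (a %/ n)%Z) z)) *+ n.
  by apply/nH/asboolP; exists (map_mx (fun a => (a %/ n)%Z) z).
rewrite raddfB /= (ptE : forall z, sum3_val (pt z) = _) uE -mulmxBr -scaler_nat scalemxAr; congr (_ *m _).
apply/matrixP=> i j; rewrite !mxE /=.
have a0 : (0 <= z i j %% n)%Z by rewrite modz_ge0 // eqz_nat -lt0n.
rewrite modn_small; last by rewrite -ltz_nat gez0_abs // ltz_pmod // ltz_nat.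
rewrite gez0_abs // [X in X%:~R - _](divz_eq _ n).
by rewrite rmorphD rmorphM addrK mulrC.
Qed.

Section QuotientGroup.
Variables (K L M : lattice R d) (h : is_lattice (lattice_sum3 K L M)).
Local Notation G := (sum3_mod_cap3 h).

Definition sum3_mod_cap3_enum : seq G :=
  undup (proj1_sig (cid (sum3_mod_cap3_finite h))).

Fact mem_sum3_mod_cap3_enum x : x \in sum3_mod_cap3_enum.
Proof. by rewrite mem_undup; apply: (proj2_sig (cid (sum3_mod_cap3_finite h))). Qed.

Fact index_sum3_mod_cap3K :
  cancel (index^~ sum3_mod_cap3_enum) (nth 0 sum3_mod_cap3_enum).
Proof. by move=> x; rewrite nth_index // mem_sum3_mod_cap3_enum. Qed.

Fact sum3_mod_cap3_enumP : Finite.axiom sum3_mod_cap3_enum.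
Proof.
apply: Finite.uniq_enumP; first exact: undup_uniq.
exact: mem_sum3_mod_cap3_enum.
Qed.

HB.instance Definition _ : isCountable G :=
  CanIsCountable index_sum3_mod_cap3K.
HB.instance Definition _ := isFinite.Build G sum3_mod_cap3_enumP.
(* The group law is addition of cosets: in [G], [x * y] is [x + y] and the
   unit [1%g] is the class [0]. *)
HB.instance Definition _ := [finGroupMixin of G for +%R].

(* The image of N in [G], for N one of K, L, M. Vectors of N outside K + L + M
   are ignored, so the definition makes sense for any N. *)
Definition lattice_mod_cap3 N : {set G} :=
  [set x | `[< exists2 u : sum3_type K L M, val u \in N & x = \pi_G u >]].

Fact lattice_mod_cap3P N (x : G) :
  reflect (exists2 u : sum3_type K L M, val u \in N & x = \pi_G u)
          (x \in lattice_mod_cap3 N).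
Proof. by rewrite inE; apply: asboolP. Qed.

Fact lattice_mod_cap3_group_set N : group_set (lattice_mod_cap3 N).
Proof.
apply/group_setP; split=> [|x y].
  apply/lattice_mod_cap3P; exists 0; first exact: rpred0.
  exact/esym/(@pi_zeror _ _ _ _ _ G).
move=> /lattice_mod_cap3P[u uN ->] /lattice_mod_cap3P[v vN ->].
apply/lattice_mod_cap3P; exists (u + v); first exact: rpredD.
exact/esym/(@pi_addr _ _ _ _ _ G).
Qed.

Canonical lattice_mod_cap3_group N := Group (lattice_mod_cap3_group_set N).

End QuotientGroup.

End Lattices.

(* Main.v *)
From HB Require Import structures.
Require Import Defs.
From mathcomp Require Import boolp classical_sets reals.
From mathcomp Require Import all_boot all_order all_algebra all_fingroup.
From mathcomp Require Import all_solvable ring_quotient zify.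

(** Everything happens in the finite group [G = (K + L + M) / H], written
    multiplicatively: intersecting with [K + L + M] and translating by coset
    representatives turn common fundamental domains of [K], [L], [M] into common
    transversals of [X], [Y], [Z] in [G] and back ([common_transversal_domain]).
    The Smith normal form makes the index of [X] a function of the volume
    ([index_volume]), so [X], [Y], [Z] have the same order; they have trivial
    common intersection and generate [G].

    Obstruction ([no_common_transversal_of_structure]). Assume the conditions on
    the Sylow subgroups, let [x], [y] be the involutions of [X2], [Y2] and let
    [s] be the product of the elements of a common transversal. Modulo [X], [s] is
    the product of all elements of [G / X]. In an abelian group with exactly one
    involution that product is the involution, and in [G / X] it is the class of
    [y]. Hence [s] lies in [y X], and likewise in [x Y] and in [x Z]. So
    [c = s x^-1 y^-1] lies in [X :&: Y], a group of odd order, while [c y] lies in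
    [Z]; an odd power gives that [y] lies in [Z], against [Y2 :&: Z2 = 1].

    Construction. Let [D] be generated by the three pairwise intersections. In
    [G / D] the images of [X], [Y], [Z] intersect pairwise trivially, and the
    subgroup [W] of the image of [X] formed by its intersection with the product of
    the other two is matched, by the equation [v t z = 1], with the analogous
    subgroups of the images of [Y] and [Z]. This gives elements of [G / D]
    coordinates [a], [b], [c] (representatives modulo these subgroups of the images
    of [X], [Y], [Z]) and [u], [v] in [W], for which the class modulo [X] depends on
    [(b, c, v)], modulo [Y] on [(a, c, u)] and modulo [Z] on [(a, b, u v^-1)]
    ([spread_family]). A family of points which takes each value of these three
    triples [#|Y :&: Z|], [#|X :&: Z|], [#|X :&: Y|] times respectively yields a
    common transversal ([common_transversal_of_spread]): coincidences are removed by
    translations by [Y :&: Z], [X :&: Z] and [X :&: Y], each of which affects the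
    class modulo one of the three subgroups only.

    Equality of orders says that the numbers of values of [a], [b], [c] are
    proportional to these multiplicities, and that is enough to distribute [a], [b],
    [c] ([array_exists]). For [u] and [v] one wants [u], [v], [u v^-1] to run through
    [W] simultaneously, and by a theorem of Marshall Hall ([hall_permutations]) this
    is possible as soon as the product of the elements of [W] is 1. When it is not,
    two repairs remain: if one of the three multiplicities is even, permutations with
    opposite defects are paired ([spread_of_even]); if the numbers of values of [a],
    [b], [c] are all even, [W] is replaced by its product with a group of order two.
    If neither applies, all these numbers are odd and [W] has a unique involution,
    and this is the exceptional configuration ([no_transversal_structure]). *)

Set Implicit Arguments.
Unset Strict Implicit.
Unset Printing Implicit Defensive.
Import GroupScope.

(** * Hall's theorem and the product of all elements of an abelian group *)

Lemma porbit_tperm_split (T : finType) (f : {perm T}) (x y : T) :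
  x != y -> x \in porbit f y -> x \notin porbit (tperm x y * f) y.
Proof.
move=> xy xfy.
have := porbits_mul_tperm f x y; rewrite xfy xy /= addn0 => E1.
have := porbits_mul_tperm (tperm x y * f) x y; cbv zeta.
rewrite mulgA tperm2 mul1g xy {}E1 addn1.
by case: (x \notin _) => //= /eqP; rewrite addn0 addn1 ltn_eqF // ltnS leqnSn.
Qed.

Lemma restr_perm_porbitE (T : finType) (f : {perm T}) (y z : T) :
  restr_perm (porbit f y) f z = if z \in porbit f y then f z else z.
Proof.
case: ifPn => [zO|]; last exact: out_perm (restr_perm_on _ _).
apply: restr_permE => //; apply/astabsP => t.
by rewrite -!eq_porbit_mem -[X in _ = (X == _)](porbit_perm f 1) expg1.
Qed.

Section Hall.
Variable gT : finGroupType.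
Hypothesis mulC : commutative (@mulg gT).

(** Rows are the elements of [gT], row [j] carrying the pair [(b j, c j)]. With
    [q = c i * c k * d], the reflection sending a pair [(b, c)] to
    [(q c^-1, q b^-1)] preserves the quotient [b c^-1]. Following the rows from [k]
    on, the reflected [b] of a row is the [b] of the next one, so reflecting the
    whole orbit of [k] only permutes the columns among these rows, and exchanging
    then the [b]'s of rows [i] and [k] gives row [i] the prescribed quotient. This
    needs [i] outside the orbit of [k]; swapping the [c]'s of rows [i] and [k]
    beforehand splits the orbit when it is not. *)
Lemma hall_exchange (b c : {perm gT}) (i k : gT) (d : gT) : i != k ->
  exists b' c' : {perm gT}, [/\
    forall j, j != i -> j != k -> b' j * (c' j)^-1 = b j * (c j)^-1
    & b' i = c' i * d].
Proof.
move=> ik; pose q := c i * c k * d.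
have mulI : injective (fun x : gT => q * x^-1) by move=> x y /mulgI/invg_inj.
pose f (c0 : {perm gT}) : {perm gT} := c0 * perm mulI * b^-1.
have fE c0 x : b (f c0 x) = q * (c0 x)^-1 by rewrite !permM permKV permE.
wlog iO : c @q mulI @f fE / i \notin porbit (f c) k => [hwlog|].
  have [iO|iO] := boolP (i \in porbit (f c) k); last exact: hwlog iO.
  pose t := tperm i k.
  have qE : (t * c) i * (t * c) k * d = q.
    by rewrite !permM tpermL tpermR [c k * _]mulC.
  have := hwlog (t * c); rewrite qE => /(_ mulI fE).
  case=> [|b' [c' [H1 H2]]].
    have -> : t * c * perm mulI * b^-1 = t * f c by rewrite /f !mulgA.
    exact: porbit_tperm_split.
  exists b', c'; split=> // j ji jk; rewrite H1 // permM tpermD //.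
    by rewrite eq_sym.
  by rewrite eq_sym.
set O := porbit (f c) k in iO; pose r := restr_perm O (f c).
have rE z : r z = if z \in O then f c z else z by exact: restr_perm_porbitE.
have rVE z : z \notin O -> r^-1 z = z.
  by move=> zO; apply: (@perm_inj _ r); rewrite permKV rE (negPf zO).
exists (tperm i k * r * b), (r^-1 * c); split=> [j ji jk|].
  rewrite !permM tpermD 1?eq_sym // rE; case: ifPn => [jO|jO]; last by rewrite rVE.
  rewrite fE.
  have : b (r (r^-1 j)) = q * (c (r^-1 j))^-1.
    rewrite rE; case: ifPn => [_|]; first exact: fE.
    move=> nO; have := rVE _ nO => E; move/negP: nO; case.
    by have := congr1 r E; rewrite !permKV => Ej; rewrite Ej.
  rewrite permKV => ->.
  by rewrite -!mulgA [_^-1 * _^-1]mulC.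
rewrite !permM tpermL rE porbit_id fE rVE // /q -!mulgA [d * _]mulC.
by rewrite mulKVg.
Qed.

(* Commutativity is only a hypothesis on [gT], so the commutative structures that
   big operators ask for are declared here, for the section. *)
Let mulg_semigroup_com_law : SemiGroup.com_law gT :=
  HB.pack (@mulg gT) (SemiGroup.isCommutativeLaw.Build gT mulg mulC).
Canonical mulg_semigroup_com_law.
Let mulg_com_law : Monoid.com_law (1 : gT) :=
  HB.pack (@mulg gT) (SemiGroup.isCommutativeLaw.Build gT mulg mulC).
Canonical mulg_com_law.

(** The rows other than 1 are corrected one at a time, row 1 absorbing the error;
    at the end the hypothesis on the product corrects row 1 too. *)
Theorem hall_permutations (a : gT -> gT) : \prod_x a x = 1 ->
  exists b c : {perm gT}, forall x, b x = c x * a x.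
Proof.
move=> a1.
have [b [c bc]] : exists b c : {perm gT},
    forall x, x \in filter (predC1 1) (enum gT) -> b x = c x * a x.
  have: uniq (filter (predC1 1) (enum gT)) by rewrite filter_uniq ?enum_uniq.
  have: all (predC1 1) (filter (predC1 1) (enum gT)) by exact: filter_all.
  elim: (filter _ _) => [|x s IHs] /= => [_ _|/andP[x1 s1] /andP[xs us]].
    by exists 1, 1.
  have [b [c bc]] := IHs s1 us.
  have [b' [c' [H1 H2]]] := hall_exchange b c (a x) x1.
  exists b', c' => y; rewrite inE; case: eqP => [-> //|/eqP yx /= ys].
  have y1 : y != 1 by exact: (allP s1).
  apply: (mulIg (c' y)^-1); rewrite H1 // bc //.
  by rewrite [c y * _]mulC [c' y * _]mulC !mulgK.
exists b, c => x; case: (eqVneq x 1) => [->|x1]; last first.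
  by apply: bc; rewrite mem_filter /= x1 mem_enum.
have rowE (p : {perm gT}) : \prod_x p x = \prod_x x.
  by rewrite [RHS](reindex_inj (@perm_inj _ p)).
have : \prod_x b x = \prod_x (c x * a x) by rewrite big_split /= a1 mulg1 !rowE.
rewrite (bigD1 (1 : gT)) //= [RHS](bigD1 (1 : gT)) //=.
rewrite [X in _ * X = _](eq_bigr (fun x => c x * a x)); last first.
  by move=> y y1; apply: bc; rewrite mem_filter /= y1 mem_enum.
exact: mulIg.
Qed.

Local Notation sigma := (\prod_(x : gT) x).

Lemma complete_mapping : sigma = 1 ->
  exists b c : {perm gT}, forall x, b x = c x * x.
Proof. exact: hall_permutations. Qed.

(** Inversion permutes the group. *)
Lemma prod_all_involution : sigma * sigma = 1.
Proof.
rewrite {2}(reindex_inj invg_inj) -big_split big1 //= => x _; exact: mulgV.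
Qed.

(** The sequence of all elements with 1 replaced by [sigma], and the one with [sigma]
    replaced by 1, both have product 1 since [sigma] is its own inverse. Together
    they take every value twice; the transposition of [bool * gT] records this as a
    bijection. *)
Lemma near_complete_mapping : exists b c : bool -> {perm gT},
  forall e x, b e x = c e x * (tperm (false, 1) (true, sigma) (e, x)).2.
Proof.
have ex e : exists bc : {perm gT} * {perm gT},
    forall x, bc.1 x = bc.2 x * (tperm (false, 1) (true, sigma) (e, x)).2.
  suff /hall_permutations[b [c bc]] :
    \prod_x (tperm (false, 1) (true, sigma) (e, x)).2 = 1 by exists (b, c).
  pose x0 := if e then sigma else 1 : gT.
  rewrite (bigD1 x0) //= [X in _ * X](eq_bigr id) => [|x xx0]; last first.
    by rewrite tpermD // xpair_eqE; move: xx0; rewrite /x0; case: (e) => //=;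
       rewrite eq_sym.
  have -> : \prod_(x | x != x0) id x = x0^-1 * sigma.
    by rewrite [in RHS](bigD1 x0) //= mulKg.
  rewrite /x0; case: (e); first by rewrite tpermR mulVg mulg1.
  by rewrite tpermL invg1 mul1g prod_all_involution.
have [bc0 H0] := ex false; have [bc1 H1] := ex true.
exists (fun e => if e then bc1.1 else bc0.1), (fun e => if e then bc1.2 else bc0.2).
by case.
Qed.

(** Each orbit of [h] is represented by its element of smallest rank. *)
Lemma prod_pairs (h : gT -> gT) (P : pred gT) : involutive h ->
    (forall x, P (h x) = P x) -> (forall x, P x -> h x != x) ->
  \prod_(x | P x) x = \prod_(x | P x && (enum_rank x < enum_rank (h x))) (x * h x).
Proof.
move=> hK Ph Pfix; rewrite (bigID (fun x => enum_rank x < enum_rank (h x))) /=.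
rewrite big_split /=; congr (_ * _).
rewrite (reindex_inj (inv_inj hK)); apply: eq_bigl => x /=.
rewrite Ph hK; case Px: (P x) => //=.
rewrite -leqNgt leq_eqVlt; case: eqP => //= E.
by have := Pfix x Px; rewrite -(enum_rank_inj (val_inj E)) eqxx.
Qed.

(** The other elements cancel with their inverses. *)
Lemma prod_all_square_roots : sigma = \prod_(x | x * x == 1) x.
Proof.
pose Om x := x * x == 1 :> gT.
rewrite (bigID Om) /= [X in _ * X](_ : _ = 1) ?mulg1 //.
rewrite (prod_pairs (h := @invg gT)).
- by rewrite big1 // => x; rewrite mulgV.
- exact: invgK.
- by move=> x; rewrite /Om -invMg eq_invg1.
- by move=> x; apply: contra => /eqP xV; rewrite /Om -{1}xV mulVg.
Qed.

(** Pairing [x] with [x * s] among the [x] with [x ^+ 2 = 1] shows that [sigma] is a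
    power of [s], for every involution [s]. *)
Lemma prod_all_unique_involution (s : gT) :
  sigma != 1 -> s * s = 1 -> s != 1 -> s = sigma.
Proof.
move=> sn1 s2 s1.
have : exists m, sigma = s ^+ m.
  rewrite prod_all_square_roots (prod_pairs (h := fun x => x * s)).
  - rewrite (eq_bigr (fun=> s)) => [|x /andP[/eqP x2 _]]; last by rewrite mulgA x2 mul1g.
    by rewrite prodg_const; eexists.
  - by move=> x; rewrite -mulgA s2 mulg1.
  - by move=> x; rewrite -mulgA [s * _]mulC -mulgA s2 mulg1.
  - by move=> x _; rewrite -[X in _ != X]mulg1 (inj_eq (mulgI x)).
case=> m; elim: m {-2}m (leqnn m) => [|n IH] [|[|m]] //= mn E.
- by case/negP: sn1; rewrite E.
- by case/negP: sn1; rewrite E.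
- by apply: (IH m); [exact: ltnW | rewrite E !expgS mulgA s2 mul1g].
Qed.

Lemma prod_all_even : sigma != 1 -> (2 %| #|gT|)%N.
Proof.
move=> s1; have <- : #[sigma] = 2%N.
  by apply: nt_prime_order => //; rewrite expgS expg1 prod_all_involution.
by rewrite -cardsT order_dvdG // inE.
Qed.

Lemma prod_all_of_unique_involution (s : gT) : s * s = 1 -> s != 1 ->
  (forall x, x * x = 1 -> x != 1 -> x = s) -> sigma = s.
Proof.
move=> s2 s1 uni; rewrite prod_all_square_roots (bigD1 s) /=; last exact/eqP.
rewrite big1 ?mulg1 // => x /andP[/eqP x2 xs]; apply/eqP/negPn/negP => x1.
by case/eqP: xs; exact: uni.
Qed.

Lemma prod_all_imset (aT : finType) (A : {set aT}) (h : aT -> gT) :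
  {in A &, injective h} -> h @: A = setT -> sigma = \prod_(x in A) h x.
Proof.
move=> inj onto; rewrite -(big_imset id inj) /= onto.
by apply: eq_bigl => x; rewrite inE.
Qed.

End Hall.

(** * Equidistributed families *)

(** [f] takes every value [d] times. The fibres are trivialised by labels in ['I_d],
    because labels are what the later constructions use and because evenness then
    amounts to an injectivity and a cardinality. *)
Definition evenly (J T : finType) (d : nat) (f : J -> T) : Prop :=
  #|J| = (d * #|T|)%N /\ exists q : J -> 'I_d, injective (fun j => (f j, q j)).

Lemma evenlyI (J T L : finType) (d : nat) (f : J -> T) (q : J -> L) :
  #|L| = d -> #|J| = (d * #|T|)%N -> injective (fun j => (f j, q j)) ->
  evenly d f.
Proof.
move=> Ld cardJ inj; split=> //; rewrite -Ld.
exists (fun j => enum_rank (q j)) => i j [fij /enum_rank_inj qij].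
by apply: inj; rewrite fij qij.
Qed.

(** A multiset of triples meeting every line parallel to the three axes of
    [A * B * C] in [dA], [dB], [dC] points. *)
Definition array (A B C : finType) (dA dB dC : nat) : Prop :=
  exists (S : finType) (a : S -> A) (b : S -> B) (c : S -> C),
    [/\ evenly dA (fun s => (b s, c s)), evenly dB (fun s => (a s, c s))
      & evenly dC (fun s => (a s, b s))].

(** The lines parallel to the third axis carry [dC] points by construction: over
    [(i, j)] they are the [dC] consecutive residues modulo [#|C|] starting at
    [dC * (i + j)]. When [i] varies and [j] is fixed these blocks are adjacent and
    cover an interval of length [#|A| * dC = #|C| * dA], that is [dA] periods. *)
Lemma array_exists (A B C : finType) (dA dB dC : nat) :
    (0 < #|C|)%N -> (#|A| * dC = #|C| * dA)%N -> (#|B| * dC = #|C| * dB)%N ->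
  array A B C dA dB dC.
Proof.
move=> C0 ACE BCE.
(* [dC * i + l] is the position of the point [l] of the block [i]. Its quotient by
   [#|C|] tells the period and serves as label, its remainder, shifted by [dC * j],
   is the third coordinate. *)
pose n (i j : nat) (l : 'I_dC) := (dC * i + l + dC * j)%N.
have nmod i j l : (n i j l %% #|C| < #|C|)%N by rewrite ltn_mod.
have nC i j l : n i j l = n j i l.
  by rewrite /n addnAC [RHS]addnAC [(dC * i + _)%N]addnC.
pose c (s : A * B * 'I_dC) : C :=
  enum_val (Ordinal (nmod (enum_rank s.1.1) (enum_rank s.1.2) s.2)).
have divP (T : finType) (d : nat) : (#|T| * dC = #|C| * d)%N ->
    forall (i : T) (l : 'I_dC), ((dC * enum_rank i + l) %/ #|C| < d)%N.
  move=> E i l; rewrite ltn_divLR // [(d * _)%N]mulnC -E [(#|T| * _)%N]mulnC.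
  apply: leq_trans (_ : dC * (enum_rank i).+1 <= _)%N.
    by rewrite mulnS [(dC + _)%N]addnC ltn_add2l.
  by rewrite leq_mul2l ltn_ord orbT.
have key (T : finType) (i i' : T) (l l' : 'I_dC) (j : nat) :
    (dC * enum_rank i + l) %/ #|C| = (dC * enum_rank i' + l') %/ #|C| ->
    n (enum_rank i) j l = n (enum_rank i') j l' %[mod #|C|] -> (i = i') * (l = l').
  move=> Ed /eqP; rewrite /n eqn_modDr => /eqP Em.
  have := divn_eq (dC * enum_rank i + l) #|C|; rewrite Ed Em -divn_eq => E.
  have dC0 : (0 < dC)%N by exact: leq_ltn_trans (leq0n l) (ltn_ord l).
  have El := congr1 (modn^~ dC) E; have Ei := congr1 (divn^~ dC) E.
  move: El Ei; rewrite ![(dC * _)%N]mulnC !modnMDl !divnMDl // !modn_small //.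
  rewrite !divn_small // !addn0 => El Ei.
  by split; [apply/enum_rank_inj/val_inj | apply/val_inj].
exists (prod (prod A B) 'I_dC), (fun s => s.1.1), (fun s => s.1.2), c; split.
- apply: (@evenlyI _ _ 'I_dA _ _
    (fun s : A * B * 'I_dC => Ordinal (divP _ _ ACE s.1.1 s.2))).
  + by rewrite card_ord.
  + rewrite !card_prod card_ord mulnAC ACE [(#|C| * _)%N]mulnC -mulnA.
    by rewrite [(#|C| * _)%N]mulnC.
  + move=> [[i j] l] [[i' j'] l'] /= [<- /enum_val_inj[Em] Ed].
    by case: (key _ _ _ _ _ _ Ed Em) => -> ->.
- apply: (@evenlyI _ _ 'I_dB _ _
    (fun s : A * B * 'I_dC => Ordinal (divP _ _ BCE s.1.2 s.2))).
  + by rewrite card_ord.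
  + by rewrite !card_prod card_ord -mulnA BCE [(#|C| * _)%N]mulnC mulnCA.
  + move=> [[i j] l] [[i' j'] l'] /= [<- /enum_val_inj[Em] Ed].
    move: Em; rewrite nC [n _ _ l']nC => Em.
    by case: (key _ _ _ _ _ _ Ed Em) => -> ->.
- apply: (@evenlyI _ _ 'I_dC _ _ (fun s : A * B * 'I_dC => s.2)).
  + by rewrite card_ord.
  + by rewrite !card_prod card_ord mulnC.
  + by move=> [[i j] l] [[i' j'] l'] [-> -> ->].
Qed.

(** The triples [(b, c, v)], [(a, c, u)] and [(a, b, u * v^-1)] are the coordinates on
    which the class of a point modulo each of three subgroups depends, as
    [spread_family] shows. *)
Definition spread (A B C : finType) (W : finGroupType) (dA dB dC : nat) : Prop :=
  exists (J : finType) (a : J -> A) (b : J -> B) (c : J -> C) (u v : J -> W),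
    [/\ evenly dA (fun j => (b j, c j, v j)), evenly dB (fun j => (a j, c j, u j))
      & evenly dC (fun j => (a j, b j, u j * (v j)^-1))].

(** A complete mapping of [Q * W] provides [(s, u)], [(t, v)] and [(s t^-1, u v^-1)]
    running through [Q * W]. With a free parameter [z] in [Q], the coordinates
    [s z], [t z], [z] then make each of the three projections bijective. *)
Lemma spread_of_zero_sum (A B C : finType) (Q W : finGroupType) (dA dB dC : nat) :
    commutative (@mulg Q) -> commutative (@mulg W) ->
    \prod_(x : Q * W) x = 1 -> array A B C dA dB dC ->
  spread (A * Q)%type (B * Q)%type (C * Q)%type W dA dB dC.
Proof.
move=> mulQ mulW zs [S [a [b [c [[cA [qA iA]] [cB [qB iB]] [cC [qC iC]]]]]]].
have mulQW : commutative (@mulg (Q * W)%type).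
  by move=> [x1 x2] [y1 y2]; congr (_, _); [exact: mulQ | exact: mulW].
have [f [g fg]] := complete_mapping mulQW zs.
have cardE m n1 n2 : #|S| = (m * (n1 * n2))%N ->
    (#|S| * #|Q| * (#|Q| * #|W|) = m * (n1 * #|Q| * (n2 * #|Q|) * #|W|))%N.
  by move=> ->; lia.
exists (S * Q * (Q * W))%type, (fun j => (a j.1.1, (f j.2).1 * j.1.2)),
  (fun j => (b j.1.1, (g j.2).1 * j.1.2)), (fun j => (c j.1.1, j.1.2)),
  (fun j => (f j.2).2), (fun j => (g j.2).2).
split.
- apply: (@evenlyI _ _ 'I_dA _ _ (fun j => qA j.1.1)); first by rewrite card_ord.
    by rewrite !card_prod; apply: cardE; rewrite cA card_prod.
  move=> [[s z] x] [[s' z'] x'] /= [Eb Et Ec Ez Ev Eq].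
  have -> : s = s' by apply: iA; rewrite Eb Ec Eq.
  move: Et; rewrite Ez => /mulIg Et; congr (_, _, _); apply: (@perm_inj _ g).
  by rewrite [g x]surjective_pairing Et Ev -surjective_pairing.
- apply: (@evenlyI _ _ 'I_dB _ _ (fun j => qB j.1.1)); first by rewrite card_ord.
    by rewrite !card_prod; apply: cardE; rewrite cB card_prod.
  move=> [[s z] x] [[s' z'] x'] /= [Eb Et Ec Ez Ev Eq].
  have -> : s = s' by apply: iB; rewrite Eb Ec Eq.
  move: Et; rewrite Ez => /mulIg Et; congr (_, _, _); apply: (@perm_inj _ f).
  by rewrite [f x]surjective_pairing Et Ev -surjective_pairing.
- apply: (@evenlyI _ _ 'I_dC _ _ (fun j => qC j.1.1)); first by rewrite card_ord.
    by rewrite !card_prod; apply: cardE; rewrite cC card_prod.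
  move=> [[s z] x] [[s' z'] x'] /= [Ea Es Eb Et Ew Eq].
  have -> : s = s' by apply: iC; rewrite Ea Eb Eq.
  have xE y : y = f y * (g y)^-1 by rewrite fg mulQW mulKg.
  have Ex1 : (f x).1 * (g x).1^-1 = (f x').1 * (g x').1^-1.
    have E0 y w : (f y).1 * (g y).1^-1 = ((f y).1 * w) * ((g y).1 * w)^-1.
      by rewrite invMg !mulgA mulgK.
    by rewrite (E0 x z) (E0 x' z') Es Et.
  have Ex : x = x'.
    rewrite (xE x) (xE x'); apply/eqP; rewrite xpair_eqE; apply/andP.
    by split; apply/eqP.
  by move: Es; rewrite Ex => /mulgI ->.
Qed.

(** The points on each line of the first direction are split into two halves, which
    use the two near complete mappings: [u] and [u v^-1] are bijective on each half,
    and the defects of [v] cancel between the halves. *)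
Lemma spread_of_even (A B C : finType) (W : finGroupType) (dA dB dC : nat) :
    commutative (@mulg W) -> array A B C dA.*2 dB dC ->
  spread A B C W dA.*2 dB dC.
Proof.
move=> mulW [S [a [b [c [[cA [qA iA]] [cB [qB iB]] [cC [qC iC]]]]]]].
have [f [g fg]] := near_complete_mapping mulW.
have label : exists l : 'I_dA.*2 -> 'I_dA * bool, injective l.
  suff h : (#|'I_dA.*2| <= #|((('I_dA) * bool)%type : finType)|)%N.
    exists (fun i => enum_val (widen_ord h (enum_rank i))).
    by move=> i j /enum_val_inj[/val_inj/enum_rank_inj].
  by rewrite card_prod !card_ord card_bool muln2.
case: label => l il; pose e s := (l (qA s)).2.
set sg := \prod_x x in fg.
(* [t] permutes [bool * W]; its first component completes the label of a point
   whose last coordinate is the second one. *)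
pose t (j : S * W) := tperm (false, 1) (true, sg) (e j.1, j.2).
exists (S * W)%type, (fun j => a j.1), (fun j => b j.1), (fun j => c j.1),
  (fun j => f (e j.1) j.2), (fun j => (t j).2); split.
- apply: (@evenlyI _ _ ('I_dA * bool)%type _ _ (fun j => ((l (qA j.1)).1, (t j).1))).
  + by rewrite card_prod card_ord card_bool muln2.
  + by rewrite !card_prod cA !card_prod !mulnA.
  + move=> [s x] [s' x'] [] => Eb Ec Et2 El Et1.
    have : t (s, x) = t (s', x').
      by rewrite [t _]surjective_pairing Et1 Et2 -surjective_pairing.
    move/perm_inj => /= [Ee Ex]; congr (_, _) => //.
    apply: iA; rewrite Eb Ec; congr (_, _); apply: il.
    by rewrite [LHS]surjective_pairing [RHS]surjective_pairing El; congr (_, _).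
- apply: (@evenlyI _ _ 'I_dB _ _ (fun j => qB j.1)); first by rewrite card_ord.
    by rewrite !card_prod cB !card_prod !mulnA.
  move=> [s x] [s' x'] /= [Ea Ec Ef Eq].
  have Es : s = s' by apply: iB; rewrite Ea Ec Eq.
  by move: Ef; rewrite Es => /perm_inj ->.
- apply: (@evenlyI _ _ 'I_dC _ _ (fun j => qC j.1)); first by rewrite card_ord.
    by rewrite !card_prod cC !card_prod !mulnA.
  move=> [s x] [s' x'] /= [Ea Eb Ef Eq].
  have Es : s = s' by apply: iC; rewrite Ea Eb Eq.
  by move: Ef; rewrite Es !fg /t /= !mulgK => /perm_inj ->.
Qed.

(** * Coordinates in a group generated by three disjoint subgroups *)

Lemma coset_reps (gT : finGroupType) (A : finType) (X H : {group gT}) :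
    H \subset X -> #|A| = #|X : H| ->
  exists a : A -> gT, (forall i, a i \in X) /\
    (forall i j, a i * (a j)^-1 \in H -> i = j).
Proof.
move=> sHX cardA; pose C i := enum_val (cast_ord cardA (enum_rank i)).
have CE i : C i = H :* repr (C i).
  have /rcosetsP[x _ Cx] : C i \in rcosets H X by exact: enum_valP.
  by rewrite Cx rcoset_repr.
exists (fun i => repr (C i)); split=> [i|i j ij].
  have /rcosetsP[x xX Cx] : C i \in rcosets H X by exact: enum_valP.
  rewrite Cx; have /rcosetP[h hH ->] := mem_repr_rcoset H x.
  by rewrite groupM // (subsetP sHX).
have: C i = C j by rewrite [LHS]CE [RHS]CE; apply/rcoset_eqP; rewrite mem_rcoset.
by move/enum_val_inj/cast_ord_inj/enum_rank_inj.
Qed.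

Section Abelian.
Variable gT : finGroupType.
Hypothesis mulC : commutative (@mulg gT).
Implicit Types X Y Z E : {group gT}.

Lemma abelian_sub_norm (A : {set gT}) X : A \subset 'N(X).
Proof.
apply: subset_trans (cent_sub X); apply/subsetP => x _; apply/centP => y _.
exact: mulC.
Qed.

Lemma abelian_mem_norm X x : x \in 'N(X).
Proof. exact: subsetP (abelian_sub_norm [set: gT] X) _ (in_setT x). Qed.

Lemma cosetM X x y : coset X (x * y) = coset X x * coset X y.
Proof. by rewrite morphM ?abelian_mem_norm. Qed.

Lemma cosetV X x : coset X x^-1 = (coset X x)^-1.
Proof. by rewrite morphV ?abelian_mem_norm. Qed.

Lemma eq_cosetE X x y : (coset X x == coset X y) = (x * y^-1 \in X).
Proof.
apply/eqP/idP => [E|xy].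
  by apply: coset_idr; rewrite ?abelian_mem_norm // cosetM cosetV E mulgV.
by apply/eqP; rewrite eq_mulgV1 -cosetV -cosetM coset_id.
Qed.

Lemma coset_subE X Y x y : X \subset Y ->
  coset X x = coset X y -> coset Y x = coset Y y.
Proof.
by move=> sXY /eqP; rewrite eq_cosetE => /(subsetP sXY); rewrite -eq_cosetE => /eqP.
Qed.

Lemma coset_joinr X Y y : y \in Y -> coset (X <*> Y) y = 1.
Proof. by move=> yY; rewrite coset_id // (subsetP (joing_subr X Y)). Qed.

Lemma joingEC X Y : X <*> Y = X * Y.
Proof. by apply: cent_joinEl; apply/centsP => x _ y _; exact: mulC. Qed.

Lemma joingPC X Y g : reflect (exists2 x, x \in X & exists2 y, y \in Y & g = x * y)
  (g \in X <*> Y).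
Proof.
rewrite joingEC; apply: (iffP mulsgP) => [[x y xX yY ->]|[x xX [y yY ->]]].
  by exists x => //; exists y.
by exists x y.
Qed.

Lemma tiE X Y x y : X :&: Y = 1 -> x \in Y -> y \in Y ->
  coset X x = coset X y -> x = y.
Proof.
move=> ti xY yY /eqP; rewrite eq_cosetE => xy.
have : x * y^-1 \in X :&: Y by rewrite inE xy groupM ?groupV.
by rewrite ti => /set1P/eqP; rewrite -eq_mulgV1 => /eqP.
Qed.

(** No coset of [X] contains more than [d] points of the family. *)
Definition labelled (J : finType) X (d : nat) (t : J -> gT) : Prop :=
  exists q : J -> 'I_d, injective (fun j => (coset X (t j), q j)).

(** Points in the same coset of [X <*> E] are moved, by elements of [E], to the coset
    of [X] prescribed by their label. *)
Lemma adjust_labelled (J : finType) X E (t : J -> gT) :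
    X :&: E = 1 -> labelled (X <*> E) #|E| t ->
  exists2 e : J -> gT, forall j, e j \in E &
    injective (fun j => coset X (t j * e j)).
Proof.
move=> tiXE [q qP]; pose b j := repr (coset (X <*> E) (t j)).
have bP j : exists e, e \in E /\ coset X (t j * e) = coset X (b j).
  have /eqP : coset (X <*> E) (b j) = coset (X <*> E) (t j) by exact: coset_reprK.
  rewrite eq_cosetE => /joingPC[x xX [e eE be]]; exists e; split=> //.
  rewrite -[b j](mulgKV (t j)) be !cosetM [coset X x]coset_id // mul1g.
  by rewrite -!cosetM mulC.
have [e0 e0P] := fin_all_exists bP.
exists (fun j => e0 j * enum_val (q j)) => [j|j j' jj'].
  by rewrite groupM ?enum_valP //; case: (e0P j).
have [e0j bj] := e0P j; have [e0j' bj'] := e0P j'.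
have tt' : coset (X <*> E) (t j) = coset (X <*> E) (t j').
  have := coset_subE (joing_subl X E) jj'.
  rewrite !cosetM !(coset_joinr X (enum_valP _)) (coset_joinr X e0j).
  by rewrite (coset_joinr X e0j') !mulg1.
apply: qP => //; congr (_, _) => //; apply/enum_val_inj.
apply: tiE tiXE (enum_valP _) (enum_valP _) _.
by move: jj'; rewrite !mulgA !(cosetM _ (_ * _)) bj bj' /b tt' => /mulgI.
Qed.

(** Modulo [X <*> Z] only [f i] is visible and modulo [X <*> Y] only [g k]; what
    is left lies in [Y], where [X] is trivial. *)
Lemma separate_coordinates X Y Z (I K : Type) (f : I -> gT) (g : K -> gT)
    i k y i' k' y' :
    X :&: Y = 1 -> (forall i, f i \in Y) -> (forall k, g k \in Z) ->
    (forall i j, f i * (f j)^-1 \in Y :&: (X <*> Z) -> i = j) ->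
    (forall i j, g i * (g j)^-1 \in Z :&: (X <*> Y) -> i = j) ->
    y \in Y :&: (X <*> Z) -> y' \in Y :&: (X <*> Z) ->
  coset X (f i * g k * y) = coset X (f i' * g k' * y') -> [/\ i = i', k = k' & y = y'].
Proof.
move=> ti fY gZ fI gI; rewrite !inE => /andP[yY yXZ] /andP[yY' yXZ'] E.
have Ei : i = i'.
  apply: fI; rewrite inE groupM ?groupV //= -eq_cosetE; apply/eqP.
  have := coset_subE (joing_subl X Z) E.
  by rewrite !cosetM !(coset_joinr _ (gZ _)) (coset_id yXZ) (coset_id yXZ') !mulg1.
move: E; rewrite Ei -!mulgA !(cosetM _ (f i')) => /mulgI E.
have Ek : k = k'.
  apply: gI; rewrite inE groupM ?groupV //= -eq_cosetE; apply/eqP.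
  have := coset_subE (joing_subl X Y) E.
  by rewrite !cosetM !(coset_joinr _ yY) !(coset_joinr _ yY') !mulg1.
move: E; rewrite Ek !cosetM => /mulgI E; split=> //.
exact: tiE ti yY yY' E.
Qed.

Section TrivialIntersections.
Variables X Y Z : {group gT}.
Hypotheses (tiXY : X :&: Y = 1) (tiXZ : X :&: Z = 1).
Let WX := (X :&: (Y <*> Z))%G.
Let WY := (Y :&: (X <*> Z))%G.
Let WZ := (Z :&: (X <*> Y))%G.

(** The family is [a * b * c * u * th v], where [th v] in [Y] satisfies
    [v * th v \in Z]. Modulo [X] the factors [a] and [u] disappear, modulo [Y] the
    factors [b] and [th v], and modulo [Z] the factor [c], while [th v] becomes
    [v^-1]. *)
Lemma spread_family (A B C : finType) (dA dB dC : nat) :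
    #|A| = #|X : WX| -> #|B| = #|Y : WY| -> #|C| = #|Z : WZ| ->
    spread A B C (subg_of WX) dA dB dC ->
  exists (J : finType) (t : J -> gT),
    [/\ #|J| = (dA * (#|B| * #|C| * #|WX|))%N,
        labelled X dA t, labelled Y dB t & labelled Z dC t].
Proof.
move=> cA cB cC [J [a [b [c [u [v [[cardJ [qA iA]] [_ [qB iB]] [_ [qC iC]]]]]]]]].
have [fa [faX faI]] := coset_reps (subsetIl _ _) cA.
have [fb [fbY fbI]] := coset_reps (subsetIl _ _) cB.
have [fc [fcZ fcI]] := coset_reps (subsetIl _ _) cC.
have uX (w : subg_of WX) : sgval w \in X :&: (Y <*> Z) by exact: (subgP w).
have thP (w : subg_of WX) : exists2 y, y \in WY & coset Z y = (coset Z (sgval w))^-1.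
  have := uX w; rewrite inE => /andP[wX /joingPC[y yY [z zZ wE]]].
  exists y^-1; last by rewrite wE cosetM [coset Z z]coset_id // mulg1 cosetV.
  rewrite !groupV inE yY /=.
  apply/joingPC; exists (sgval w) => //; exists z^-1; first by rewrite groupV.
  by rewrite wE mulgK.
have {thP}[th thW thZ] := fin_all_exists2 thP.
have thI w w' : th w = th w' -> w = w'.
  move/(congr1 (coset Z)); rewrite !thZ => /invg_inj E; apply/val_inj => /=.
  have [[wX _] [wX' _]] := (setIP (uX w), setIP (uX w')).
  by apply: (tiE _ wX wX' E); rewrite setIC.
pose t j := fa (a j) * fb (b j) * fc (c j) * sgval (u j) * th (v j).
have [uX1 thY] : (forall w : subg_of WX, sgval w \in X) * (forall w, th w \in Y).
  by split=> w; [case/setIP: (uX w) | case/setIP: (thW w)].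
exists J, t; split.
- by rewrite cardJ !card_prod card_sub.
- exists qA => j j' [E Eq].
  have {}E : coset X (fb (b j) * fc (c j) * th (v j)) =
      coset X (fb (b j') * fc (c j') * th (v j')).
    move: E; rewrite /t !cosetM !(coset_id (faX _)) !(coset_id (uX1 _)).
    by rewrite !mul1g !mulg1.
  have [Eb Ec /thI Ev] := separate_coordinates tiXY fbY fcZ fbI fcI (thW _) (thW _) E.
  by apply: iA; rewrite Eb Ec Ev Eq.
- exists qB => j j' [E Eq].
  have {}E : coset Y (fa (a j) * fc (c j) * sgval (u j)) =
      coset Y (fa (a j') * fc (c j') * sgval (u j')).
    move: E; rewrite /t !cosetM !(coset_id (fbY _)) !(coset_id (thY _)).
    by rewrite !mulg1.
  have tiYX : Y :&: X = 1 by rewrite setIC.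
  rewrite /WZ /= [X <*> Y]joingC in fcI.
  have [Ea Ec /val_inj Eu] := separate_coordinates tiYX faX fcZ faI fcI (uX _) (uX _) E.
  by apply: iB; rewrite Ea Ec Eu Eq.
- exists qC => j j' [E Eq].
  have {}E : coset Z (fa (a j) * fb (b j) * sgval (u j * (v j)^-1)) =
      coset Z (fa (a j') * fb (b j') * sgval (u j' * (v j')^-1)).
    move: E; rewrite /t !cosetM !(coset_id (fcZ _)) !thZ.
    by rewrite !mulg1 !cosetV -!mulgA.
  have tiZX : Z :&: X = 1 by rewrite setIC.
  rewrite /WX /WY /= [Y <*> Z]joingC in faI uX.
  rewrite /WY /= [X <*> Z]joingC in fbI.
  have [Ea Eb /val_inj Eu] := separate_coordinates tiZX faX fbY faI fbI (uX _) (uX _) E.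
  by apply: iC; rewrite Ea Eb Eu Eq.
Qed.
End TrivialIntersections.
End Abelian.

(** * Reduction of common transversals to equidistributed families *)

Definition transversal (gT : finGroupType) (X T : {set gT}) : Prop :=
  forall g, exists! t, t \in T /\ g * t^-1 \in X.

Definition common_transversal (gT : finGroupType) (X Y Z : {set gT}) : Prop :=
  exists T : {set gT}, [/\ transversal X T, transversal Y T & transversal Z T].

Section Abelian.
Variable gT : finGroupType.
Hypothesis mulC : commutative (@mulg gT).
Implicit Types X Y Z E : {group gT}.

Lemma coset_mulC E : commutative (@mulg (coset_of E)).
Proof.
by move=> x y; rewrite -(coset_reprK x) -(coset_reprK y) -!cosetM // mulC.
Qed.

Lemma subg_mulC E : commutative (@mulg (subg_of E)).
Proof. by move=> x y; apply: val_inj; exact: mulC. Qed.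

Lemma joingCA (A B C : {set gT}) : A <*> (B <*> C) = B <*> (A <*> C).
Proof. by rewrite !joingA [A <*> B]joingC. Qed.

Lemma quotient_setT E : [set: gT] / E = [set: coset_of E].
Proof.
suff -> : [set: gT] = 'N(E) by exact: im_quotient.
by apply/setP=> x; rewrite inE abelian_mem_norm.
Qed.

Lemma transversal_of_injective (J : finType) X (s : J -> gT) :
    #|J| = #|[set: gT] : X| -> injective (fun j => coset X (s j)) ->
  transversal X [set s j | j in [set: J]].
Proof.
move=> cardJ inj g.
have onto : coset X g \in codom (fun j => coset X (s j)).
  apply: inj_card_onto => //.
  by rewrite cardJ -card_quotient ?abelian_sub_norm // quotient_setT cardsT.
have /codomP[j gj] := onto; exists (s j); split.
  by split; [exact: imset_f | rewrite -eq_cosetE // gj].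
move=> _ [/imsetP[j' _ ->] gj']; congr s; apply: inj; rewrite /= -gj; apply/eqP.
by rewrite eq_cosetE.
Qed.

Lemma card_span3 X Y Z : Y :&: Z = 1 -> X <*> (Y <*> Z) = [set: gT] ->
  (#|X| * #|Y| * #|Z|)%N = (#|gT| * #|X :&: (Y <*> Z)|)%N.
Proof.
move=> tiYZ full; rewrite -cardsT -full (joingEC mulC X (Y <*> Z)%G) -mul_cardG.
by rewrite /= (joingEC mulC Y) TI_cardMg // mulnA.
Qed.

(** The analogues of [W] in [Y] and [Z] have the order of [W], because the product in
    [card_span3] does not depend on the order of the subgroups. *)
Lemma card_middle X Y Z : X :&: Y = 1 -> X :&: Z = 1 -> Y :&: Z = 1 ->
    X <*> (Y <*> Z) = [set: gT] ->
  let W := X :&: (Y <*> Z) in let eX := #|X : W| in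
  let eY := #|Y : Y :&: (X <*> Z)| in let eZ := #|Z : Z :&: (X <*> Y)| in
  [/\ #|X| = (eX * #|W|)%N, #|Y| = (eY * #|W|)%N, #|Z| = (eZ * #|W|)%N
    & #|gT| = (eX * eY * eZ * #|W| * #|W|)%N].
Proof.
move=> tiXY tiXZ tiYZ full W eX eY eZ.
have cX := card_span3 tiYZ full.
have cY : (#|X| * #|Y| * #|Z|)%N = (#|gT| * #|Y :&: (X <*> Z)|)%N.
  by rewrite -card_span3 //; [rewrite [(#|X| * _)%N]mulnC | rewrite joingCA].
have cZ : (#|X| * #|Y| * #|Z|)%N = (#|gT| * #|Z :&: (X <*> Y)|)%N.
  by rewrite -card_span3 //; [rewrite -[RHS]mulnA mulnC | rewrite joingC -joingA].
have gT0 : (0 < #|gT|)%N by rewrite -cardsT cardG_gt0.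
have WY : #|Y :&: (X <*> Z)| = #|W|.
  by apply/eqP; rewrite -(eqn_pmul2l gT0) -cY cX.
have WZ : #|Z :&: (X <*> Y)| = #|W|.
  by apply/eqP; rewrite -(eqn_pmul2l gT0) -cZ cX.
have EX : #|X| = (eX * #|W|)%N by rewrite mulnC Lagrange ?subsetIl.
have EY : #|Y| = (eY * #|W|)%N by rewrite mulnC -WY Lagrange ?subsetIl.
have EZ : #|Z| = (eZ * #|W|)%N by rewrite mulnC -WZ Lagrange ?subsetIl.
split=> //; have W0 : (0 < #|W|)%N by exact: cardG_gt0.
apply/eqP; rewrite -(eqn_pmul2r W0) -cX EX EY EZ; apply/eqP.
rewrite -!mulnA; congr (_ * _)%N; rewrite mulnCA; congr (_ * _)%N.
by rewrite [(_ * (eZ * _))%N in LHS]mulnCA [LHS]mulnCA.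
Qed.

(** The join of the pairwise intersections: the smallest subgroup modulo which
    [X], [Y], [Z] become pairwise disjoint. *)
Definition core X Y Z : {group gT} :=
  ((Y :&: Z) <*> ((X :&: Z) <*> (X :&: Y)))%G.

Lemma core12 X Y Z : core Y X Z = core X Y Z.
Proof. by apply: val_inj; rewrite /= [Y :&: X]setIC joingCA. Qed.

Lemma core23 X Y Z : core X Z Y = core X Y Z.
Proof. by apply: val_inj; rewrite /= [Z :&: Y]setIC [(X :&: Y) <*> _]joingC. Qed.

Section Core.
Variables X Y Z : {group gT}.
Hypothesis cap1 : X :&: Y :&: Z = 1.
Let D := core X Y Z.

Lemma core_ti : X :&: (Y :&: Z) = 1. Proof. by rewrite setIA. Qed.

(** Two of the three intersections lie in [X], so that only [Y :&: Z] enlarges it. *)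
Lemma join_core : X <*> (Y :&: Z) = X <*> D.
Proof.
rewrite /D /core /= joingCA joingC; congr (_ <*> _); apply/esym/joing_idPl.
by rewrite join_subG !subsetIl.
Qed.

(** If [x] in [X] and [y] in [Y] differ by a product of [a], [b], [c] in the three
    intersections, then [x * (b * c)^-1 = a * y] lies in [X :&: Y]. *)
Lemma quotient_core_ti : X / D :&: Y / D = 1.
Proof.
apply/trivgP/subsetP => _ /setIP[/morphimP[x _ xX ->] /morphimP[y _ yY /= E]].
apply/set1P; rewrite coset_id //.
move/eqP: E; rewrite eq_cosetE // => /joingPC-/(_ mulC)[a /setIP[aY aZ]].
case=> bc /joingPC-/(_ mulC)[b /setIP[bX bZ] [c /setIP[cX cY] ->]] E.
have Ex : x * (b * c)^-1 = a * y.
  by rewrite -[x](mulgKV y) E -[a * _ * y]mulgA [b * c * y]mulC mulgA mulgK.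
have sXZ : X :&: Z \subset D by rewrite /D /= joingCA joing_subl.
have sXY : X :&: Y \subset D by rewrite /D /= joingA joing_subr.
have bcD : b * c \in D.
  by rewrite groupM ?(subsetP sXZ b) ?(subsetP sXY c) // inE ?bX ?cX.
rewrite -[x](mulgKV (b * c)) groupM //; apply: (subsetP sXY).
by rewrite inE {2}Ex !(groupM, groupV).
Qed.

Lemma card_core_cap : #|X :&: D| = (#|X :&: Z| * #|X :&: Y|)%N.
Proof.
have -> : X :&: D = (X :&: Z) <*> (X :&: Y).
  rewrite /D /core /= joingC joingEC // setIC -group_modl; last first.
    by rewrite join_subG !subsetIl.
  by rewrite [_ :&: X]setIC core_ti mulg1.
rewrite joingEC // TI_cardMg //; apply/trivgP; rewrite -cap1.
by apply/subsetP => x /setIP[/setIP[xX xZ] /setIP[_ xY]]; rewrite !inE xX xY.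
Qed.

Lemma card_quotient_core : #|X| = (#|X / D| * (#|X :&: Z| * #|X :&: Y|))%N.
Proof.
rewrite card_quotient ?abelian_sub_norm // -indexgI -card_core_cap mulnC.
by rewrite Lagrange ?subsetIl.
Qed.

Lemma card_core : #|D| = (#|Y :&: Z| * #|X :&: Z| * #|X :&: Y|)%N.
Proof.
have ti : (Y :&: Z) :&: ((X :&: Z) <*> (X :&: Y)) = 1.
  apply/trivgP; rewrite -core_ti [X :&: (Y :&: Z)]setIC; apply: setIS.
  by rewrite join_subG !subsetIl.
rewrite /D /core /= joingEC // TI_cardMg // /= joingEC // TI_cardMg ?mulnA //.
apply/trivgP; rewrite -cap1.
by apply/subsetP => x /setIP[/setIP[xX xZ] /setIP[_ xY]]; rewrite !inE xX xY.
Qed.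

End Core.

Lemma labelled_lift (J : finType) X (D : {group gT}) E (d : nat) (t : J -> coset_of D) :
    X <*> E = X <*> D -> labelled (X / D) d t ->
  labelled (X <*> E) d (fun j => repr (t j)).
Proof.
move=> XED [q qP]; exists q => j j' [/eqP E1 Eq]; apply: qP; congr (_, _) => //; apply/eqP.
rewrite eq_cosetE; last exact: coset_mulC.
rewrite -(coset_reprK (t j)) -(coset_reprK (t j')) -cosetV // -cosetM //.
move: E1; rewrite eq_cosetE //= XED => /joingPC-/(_ mulC)[x xX [y yD ->]].
by rewrite cosetM // (coset_id yD) mulg1 mem_quotient.
Qed.

End Abelian.

Section Triple.
Variable gT : finGroupType.
Hypothesis mulC : commutative (@mulg gT).
Variables X Y Z : {group gT}.
Hypotheses (cap1 : X :&: Y :&: Z = 1) (full : X <*> (Y <*> Z) = [set: gT]).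
Let D := core X Y Z.

(** The lattice of subgroups generated by [X], [Y], [Z] has a diamond in its middle,
    with least element [D]: this is its part below [X / D], seen in [coset_of D]. The
    stretches are the indices of this subgroup and its two analogues in [X / D],
    [Y / D] and [Z / D]. *)
Definition middle : {group coset_of D} := (X / D :&: ((Y / D) <*> (Z / D)))%G.
Definition stretchX := #|X / D : middle|.
Definition stretchY := #|Y / D : Y / D :&: ((X / D) <*> (Z / D))|.
Definition stretchZ := #|Z / D : Z / D :&: ((X / D) <*> (Y / D))|.
Let dX := #|Y :&: Z|.
Let dY := #|X :&: Z|.
Let dZ := #|X :&: Y|.

Lemma cap1_12 : Y :&: X :&: Z = 1. Proof. by rewrite [Y :&: X]setIC. Qed.
Lemma cap1_31 : Z :&: X :&: Y = 1. Proof. by rewrite -setIA setIC. Qed.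

Lemma quotient_tiXY : X / D :&: Y / D = 1. Proof. exact: quotient_core_ti. Qed.
Lemma quotient_tiXZ : X / D :&: Z / D = 1.
Proof. by have := quotient_core_ti mulC X Z Y; rewrite core23. Qed.
Lemma quotient_tiYZ : Y / D :&: Z / D = 1.
Proof.
by have := quotient_core_ti mulC Y Z X; rewrite [core Y Z X]core23 core12.
Qed.

Lemma card_parameters :
  [/\ #|X| = (stretchX * #|middle| * (dY * dZ))%N,
      #|Y| = (stretchY * #|middle| * (dX * dZ))%N,
      #|Z| = (stretchZ * #|middle| * (dX * dY))%N
    & #|gT| = (stretchX * stretchY * stretchZ * #|middle| * #|middle| *
        (dX * dY * dZ))%N].
Proof.
have full' : (X / D)%G <*> ((Y / D)%G <*> (Z / D)%G) = [set: coset_of D].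
  by rewrite -(quotient_setT mulC) -full /= !quotientY ?abelian_sub_norm.
have [cX cY cZ cT] := card_middle (coset_mulC mulC (E:=D))
  quotient_tiXY quotient_tiXZ quotient_tiYZ full'.
split.
- by rewrite (card_quotient_core mulC cap1) -/D cX.
- have := card_quotient_core mulC cap1_12; rewrite core12 -/D cY => ->.
  by rewrite [Y :&: X]setIC.
- have := card_quotient_core mulC cap1_31; rewrite core12 core23 -/D cZ => ->.
  by rewrite [Z :&: X]setIC [Z :&: Y]setIC.
- rewrite -(card_core mulC cap1) -/D mulnC -cT.
  have : #|[set: coset_of D]| = #|[set: gT] : D|.
    by rewrite -card_quotient ?abelian_sub_norm // quotient_setT.
  rewrite cardsT => ->.
  by rewrite Lagrange ?subsetT // cardsT.
Qed.

(** The translations by [Y :&: Z], [X :&: Z] and [X :&: Y] do not interfere: each of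
    these groups is contained in two of [X], [Y], [Z], hence invisible modulo them. *)
Lemma common_transversal_of_spread (A B C : finType) :
    #|X| = #|Y| -> #|X| = #|Z| ->
    #|A| = stretchX -> #|B| = stretchY -> #|C| = stretchZ ->
    spread A B C (subg_of middle) dX dY dZ ->
  common_transversal X Y Z.
Proof.
move=> XY XZ cA cB cC sp.
have [J [t [cardJ lX lY lZ]]] :=
  spread_family (coset_mulC mulC (E:=D)) quotient_tiXY quotient_tiXZ cA cB cC sp.
have [cX _ _ cT] := card_parameters.
have {}cardJ : #|J| = (dX * (#|B| * #|C| * #|middle|))%N := cardJ.
have {}cardJ : #|J| = #|[set: gT] : X|.
  apply/eqP; rewrite -(eqn_pmul2l (cardG_gt0 X)) Lagrange ?subsetT // cardsT.
  by rewrite cardJ cT cX cB cC; apply/eqP; lia.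
have joinY : Y <*> (X :&: Z) = Y <*> D by rewrite (join_core Y X Z) core12.
have joinZ : Z <*> (X :&: Y) = Z <*> D.
  rewrite [X :&: Y]setIC /D -(core12 X Y Z) -(core23 Y X Z) -(core12 Y Z X).
  exact: join_core.
have [eX eXP iX] := adjust_labelled mulC (core_ti cap1)
  (labelled_lift mulC (join_core X Y Z) lX).
have tY : Y :&: (X :&: Z) = 1 by rewrite setICA setIA.
have tZ : Z :&: (X :&: Y) = 1 by rewrite setIC.
have [eY eYP iY] := adjust_labelled mulC tY (labelled_lift mulC joinY lY).
have [eZ eZP iZ] := adjust_labelled mulC tZ (labelled_lift mulC joinZ lZ).
pose s j := repr (t j) * eX j * eY j * eZ j.
have mX j : (eY j \in X) * (eZ j \in X).
  by case/setIP: (eYP j) => -> _; case/setIP: (eZP j) => ->.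
have mY j : (eX j \in Y) * (eZ j \in Y).
  by case/setIP: (eXP j) => -> _; case/setIP: (eZP j) => _ ->.
have mZ j : (eX j \in Z) * (eY j \in Z).
  by case/setIP: (eXP j) => _ ->; case/setIP: (eYP j) => _ ->.
exists [set s j | j in [set: J]]; split; apply: transversal_of_injective => //.
- move=> j j' E; apply: iX; move: E; rewrite /s !cosetM //.
  by rewrite !(coset_id (mX _).1) !(coset_id (mX _).2) !mulg1.
- by rewrite cardJ -!divgS ?subsetT // XY.
- move=> j j' E; apply: iY; move: E; rewrite /s !cosetM //.
  by rewrite !(coset_id (mY _).1) !(coset_id (mY _).2) !mulg1.
- by rewrite cardJ -!divgS ?subsetT // XZ.
- move=> j j' E; apply: iZ; move: E; rewrite /s !cosetM //.
  by rewrite !(coset_id (mZ _).1) !(coset_id (mZ _).2) !mulg1.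
Qed.
End Triple.

(** * Existence of common transversals *)

Section ProdPair.
Variables (W : finGroupType) (I : finType).
Hypothesis mulW : commutative (@mulg W).

Let W_semigroup_com_law : SemiGroup.com_law W :=
  HB.pack (@mulg W) (SemiGroup.isCommutativeLaw.Build W mulg mulW).
Canonical W_semigroup_com_law.
Let W_com_law : Monoid.com_law (1 : W) :=
  HB.pack (@mulg W) (SemiGroup.isCommutativeLaw.Build W mulg mulW).
Canonical W_com_law.

Lemma prod_fst : \prod_(x : W * I) x.1 = (\prod_w w) ^+ #|I|.
Proof.
rewrite -(pair_bigA _ (fun (w : W) (_ : I) => w)) /= exchange_big /=.
by rewrite prodg_const.
Qed.

Lemma prod_snd : \prod_(x : I * W) x.2 = (\prod_w w) ^+ #|I|.
Proof.
rewrite -(pair_bigA _ (fun (_ : I) (w : W) => w)) /=.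
by rewrite prodg_const.
Qed.
End ProdPair.

Lemma prod_all_pair (Q W : finGroupType) :
    commutative (@mulg Q) -> commutative (@mulg W) ->
  \prod_(x : Q * W) x = ((\prod_(q : Q) q) ^+ #|W|, (\prod_(w : W) w) ^+ #|Q|) :> Q * W.
Proof.
move=> mulQ mulW.
rewrite [LHS]surjective_pairing; congr (_, _).
  by rewrite (big_morph fst (id1 := 1) (op1 := mulg)) // -prod_fst.
by rewrite (big_morph snd (id1 := 1) (op1 := mulg)) // -prod_snd.
Qed.

Section Cases.
Variable gT : finGroupType.
Hypothesis mulC : commutative (@mulg gT).

Section Triple.
Variables X Y Z : {group gT}.
Hypotheses (cap1 : X :&: Y :&: Z = 1) (full : X <*> (Y <*> Z) = [set: gT]).
Hypotheses (XY : #|X| = #|Y|) (XZ : #|X| = #|Z|).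
Let W := middle X Y Z.
Let eX := stretchX X Y Z.
Let eY := stretchY X Y Z.
Let eZ := stretchZ X Y Z.
Let dX := #|Y :&: Z|.
Let dY := #|X :&: Z|.
Let dZ := #|X :&: Y|.

(** The two sides of each equality differ from the orders of two of the subgroups by
    the same factor. *)
Lemma stretch_ratio : [/\ (eX * dY = eY * dX)%N, (eX * dZ = eZ * dX)%N
  & (eY * dZ = eZ * dY)%N].
Proof.
have [cX cY cZ _] := card_parameters mulC cap1 full.
have W0 : (0 < #|W|)%N := cardG_gt0 _.
have dX0 : (0 < dX)%N := cardG_gt0 _.
have dY0 : (0 < dY)%N := cardG_gt0 _.
have dZ0 : (0 < dZ)%N := cardG_gt0 _.
have YZ : #|Y| = #|Z| by rewrite -XY.
split; apply/eqP.
- rewrite -(eqn_pmul2r W0) -(eqn_pmul2r dZ0); apply/eqP.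
  by move: XY; rewrite cX cY -/dX -/dY -/dZ -/W -/eX -/eY; lia.
- rewrite -(eqn_pmul2r W0) -(eqn_pmul2r dY0); apply/eqP.
  by move: XZ; rewrite cX cZ -/dX -/dY -/dZ -/W -/eX -/eZ; lia.
- rewrite -(eqn_pmul2r W0) -(eqn_pmul2r dX0); apply/eqP.
  by move: YZ; rewrite cY cZ -/dX -/dY -/dZ -/W -/eY -/eZ; lia.
Qed.

Lemma stretch_gt0 : [/\ (0 < eX)%N, (0 < eY)%N & (0 < eZ)%N].
Proof. by split; exact: indexg_gt0. Qed.

Lemma common_transversal_even_cap : ~~ odd dX -> common_transversal X Y Z.
Proof.
move=> evX; have [E1 E2 E3] := stretch_ratio; have [eX0 eY0 eZ0] := stretch_gt0.
apply: (common_transversal_of_spread mulC cap1 full XY XZ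
  (A := 'I_eX) (B := 'I_eY) (C := 'I_eZ)); rewrite ?card_ord //.
have dXE : dX = (dX./2).*2 by rewrite even_halfK.
rewrite -/dX dXE; apply: spread_of_even; first exact/subg_mulC/coset_mulC.
by rewrite -dXE; apply: array_exists; rewrite !card_ord.
Qed.

(** [Q] takes a factor out of the three coordinates [a], [b], [c] and joins it to
    [W]. *)
Lemma common_transversal_zero_sum (Q : finGroupType) :
    commutative (@mulg Q) -> \prod_(x : Q * subg_of W) x = 1 ->
    (#|Q| %| eX)%N -> (#|Q| %| eY)%N -> (#|Q| %| eZ)%N ->
  common_transversal X Y Z.
Proof.
move=> mulQ zs /dvdnP[x Ex] /dvdnP[y Ey] /dvdnP[z Ez].
have [E1 E2 E3] := stretch_ratio; have [eX0 eY0 eZ0] := stretch_gt0.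
have Q0 : (0 < #|Q|)%N by rewrite -cardsT cardG_gt0.
apply: (common_transversal_of_spread mulC cap1 full XY XZ
  (A := ('I_x * Q)%type) (B := ('I_y * Q)%type) (C := ('I_z * Q)%type));
  rewrite ?card_prod ?card_ord //.
apply: spread_of_zero_sum => //; first exact/subg_mulC/coset_mulC.
apply: array_exists; rewrite !card_ord.
- by move: eZ0; rewrite Ez muln_gt0 => /andP[].
- by apply/eqP; rewrite -(eqn_pmul2r Q0); apply/eqP; move: E2; rewrite Ex Ez -/dX -/dZ; lia.
- by apply/eqP; rewrite -(eqn_pmul2r Q0); apply/eqP; move: E3; rewrite Ey Ez -/dY -/dZ; lia.
Qed.

Let sigma := \prod_(w : subg_of W) w.

Lemma no_common_transversal_sigma : ~ common_transversal X Y Z -> sigma != 1.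
Proof.
move=> nct; apply/negP => /eqP s1; apply: nct.
have cQ : #|'I_1| = 1%N by rewrite card_ord.
apply: (@common_transversal_zero_sum 'I_1); rewrite ?cQ ?dvd1n //.
  by move=> i j; rewrite !ord1.
rewrite prod_all_pair.
- by rewrite -/sigma s1 expg1n [X in (X, _)]ord1.
- by move=> i j; rewrite !ord1.
- exact/subg_mulC/coset_mulC.
Qed.

(** Both factors of the product over ['I_2 * W] are even powers of elements of order
    at most two. *)
Lemma no_common_transversal_stretch : ~ common_transversal X Y Z ->
  ~~ [&& ~~ odd eX, ~~ odd eY & ~~ odd eZ].
Proof.
move=> nct; apply/negP => /and3P[oX oY oZ].
have s1 := no_common_transversal_sigma nct; apply: nct.
have cQ : #|'I_2| = 2%N by rewrite card_ord.
have mulQ : commutative (@mulg 'I_2) by move=> i j; exact: GRing.addrC.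
have mulW : commutative (@mulg (subg_of W)) by exact/subg_mulC/coset_mulC.
have s2 := prod_all_involution mulW.
have q2 := prod_all_involution mulQ.
apply: (@common_transversal_zero_sum 'I_2); rewrite ?cQ ?dvdn2 //.
rewrite prod_all_pair // cQ expgS expg1 s2.
have /dvdnP[m ->] := prod_all_even mulW s1.
by rewrite mulnC expgM [_ ^+ 2]q2 expg1n.
Qed.

End Triple.
End Cases.

(** * Structure of the triples without common transversal *)

Lemma common_transversal12 (gT : finGroupType) (X Y Z : {set gT}) :
  common_transversal Y X Z -> common_transversal X Y Z.
Proof. by case=> T [? ? ?]; exists T. Qed.

Lemma common_transversal23 (gT : finGroupType) (X Y Z : {set gT}) :
  common_transversal X Z Y -> common_transversal X Y Z.
Proof. by case=> T [? ? ?]; exists T. Qed.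

Lemma odd_involution (gT : finGroupType) (H : {group gT}) x :
  odd #|H| -> x \in H -> x * x = 1 -> x = 1.
Proof.
move=> oH xH x2; apply/eqP; rewrite -order_eq1.
have := order_dvdG xH; have : (#[x] %| 2)%N by rewrite order_dvdn expgS expg1 x2.
rewrite dvdn_divisors // !inE => /orP[//|/eqP->].
by rewrite dvdn2 oH.
Qed.

Section Structure.
Variable gT : finGroupType.
Hypothesis mulC : commutative (@mulg gT).
Implicit Types X Y Z : {group gT}.

Lemma odd_index_involution X (H : {group gT}) x :
  odd #|X : H| -> x \in X -> x * x = 1 -> x \in H.
Proof.
move=> oXH xX x2; apply: coset_idr; first exact: abelian_mem_norm.
apply: (@odd_involution _ (X / H)%G).
- by rewrite card_quotient ?abelian_sub_norm.
- exact: mem_quotient.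
- by rewrite -cosetM // x2 morph1.
Qed.

(** An abelian 2-group of rank at least two contains an elementary abelian group of
    order four. *)
Lemma cyclic_unique_involution (P : {group gT}) : 2.-group P ->
    (forall x y, x \in P -> y \in P -> x * x = 1 -> y * y = 1 ->
      x != 1 -> y != 1 -> x = y) ->
  cyclic P.
Proof.
move=> pP uniP.
have abP : abelian P by apply/centsP => x _ y _; exact: mulC.
rewrite abelian_rank1_cyclic // (rank_pgroup pP) leqNgt; apply/negP.
move/p_rank_geP => [E /[dup] EE /pnElemP[sEP abE _]].
have := card_pnElem EE; case: (eqVneq (E : {set gT}) 1) => [->|nE]; first by rewrite cards1.
have [x xE x1] : exists2 x, x \in E & x != 1 by apply/trivgPn.
have sq y : y \in E -> y * y = 1.
  by move=> yE; case/abelemP: abE => // _ /(_ y yE); rewrite expgS expg1.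
move=> cE; have : (#|E| <= #|[set 1%g; x]|)%N.
  apply: subset_leq_card; apply/subsetP => y yE; rewrite !inE.
  case: (eqVneq y 1) => //= y1; apply/eqP.
  by apply: uniP; rewrite ?(subsetP sEP) ?sq.
by rewrite cE cards2; case: (_ != _).
Qed.

End Structure.

Section NoTransversal.
Variable gT : finGroupType.
Hypothesis mulC : commutative (@mulg gT).
Variables X Y Z : {group gT}.
Hypotheses (cap1 : X :&: Y :&: Z = 1) (full : X <*> (Y <*> Z) = [set: gT]).
Hypotheses (XY : #|X| = #|Y|) (XZ : #|X| = #|Z|).
Hypothesis nct : ~ common_transversal X Y Z.

Let D := core X Y Z.
Let W := middle X Y Z.
Let eX := stretchX X Y Z.
Let eY := stretchY X Y Z.
Let eZ := stretchZ X Y Z.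

Lemma odd_caps : [/\ odd #|Y :&: Z|, odd #|X :&: Z| & odd #|X :&: Y|].
Proof.
split; apply/negPn/negP => ev; apply: nct.
- exact: common_transversal_even_cap.
- apply/common_transversal12/common_transversal_even_cap => //.
  + by rewrite [Y :&: X]setIC.
  + by rewrite joingCA.
  + by rewrite -XY.
- apply/common_transversal23/common_transversal12/common_transversal_even_cap => //.
  + by rewrite -setIA setIC.
  + by rewrite joingC -joingA.
  + by rewrite -XZ.
Qed.

Lemma odd_stretches : [/\ odd eX, odd eY & odd eZ].
Proof.
have [oX oY oZ] := odd_caps.
have [E1 E2 _] := stretch_ratio mulC cap1 full XY XZ.
have := no_common_transversal_stretch mulC cap1 full XY XZ nct.
have := congr1 odd E1; have := congr1 odd E2.
rewrite !oddM oX oY oZ !andbT -/eX -/eY -/eZ => <- <-.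
by rewrite andbb andbb negbK.
Qed.

Lemma odd_core : odd #|D|.
Proof. by have [oX oY oZ] := odd_caps; rewrite (card_core mulC cap1) !oddM oX oY oZ. Qed.

Lemma even_card : (2 %| #|X|)%N.
Proof.
have s1 := no_common_transversal_sigma mulC cap1 full XY XZ nct.
have mulW : commutative (@mulg (subg_of W)) by exact/subg_mulC/coset_mulC.
have [-> _ _ _] := card_parameters mulC cap1 full.
apply: dvdn_mulr; apply: dvdn_mull.
have <- : #|subg_of W| = #|W| by rewrite card_sub.
exact: prod_all_even mulW s1.
Qed.

(** Involutions of [X] survive modulo the core, which has odd order, and land in the
    middle, which has odd index; the middle has only one. *)
Lemma unique_involution x y : x \in X -> y \in X ->
  x * x = 1 -> y * y = 1 -> x != 1 -> y != 1 -> x = y.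
Proof.
move=> xX yX x2 y2 x1 y1.
have s1 := no_common_transversal_sigma mulC cap1 full XY XZ nct.
have mulW : commutative (@mulg (subg_of W)) by exact/subg_mulC/coset_mulC.
have [oeX _ _] := odd_stretches.
have key z : z \in X -> z * z = 1 -> z != 1 ->
    coset D z = sgval (\prod_(w : subg_of W) w).
  move=> zX z2 z1.
  have zz : coset D z * coset D z = 1 by rewrite -cosetM // z2 morph1.
  have zn : coset D z != 1.
    apply: contra z1 => /eqP zD; apply/eqP.
    apply: (odd_involution odd_core) => //.
    by apply: coset_idr => //; exact: abelian_mem_norm.
  have zW : coset D z \in W.
    apply: (odd_index_involution (coset_mulC mulC (E:=D)) oeX) => //.
    exact: mem_quotient.
  rewrite -(prod_all_unique_involution mulW (s := subg W (coset D z)) s1).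
  - by rewrite subgK.
  - by apply: val_inj; rewrite /= subgK // zz.
  - by apply: contra zn => /eqP/(congr1 val) /=; rewrite subgK // => ->.
have /eqP : coset D x = coset D y by rewrite !key.
rewrite eq_cosetE // => xyD; apply/eqP; rewrite eq_mulgV1; apply/eqP.
apply: (odd_involution odd_core xyD).
by rewrite mulgA -[x * _ * x]mulgA [y^-1 * x]mulC mulgA x2 mul1g -invMg y2 invg1.
Qed.

(** Up to odd factors [#|X|] and [#|Y|] are [#|W|] and [#|gT|] is [#|W| ^ 2], so that
    [X2] and [Y2], which are disjoint, fill [G2]. *)
Lemma no_transversal_structure (X2 Y2 G2 : {group gT}) :
    2.-Sylow(X) X2 -> 2.-Sylow(Y) Y2 -> 2.-Sylow([set: gT]) G2 ->
  [/\ X2 <> 1%G, cyclic X2, X2 :&: Y2 = 1 & X2 \x Y2 = G2].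
Proof.
move=> sX sY sG.
have [oX oY oZ] := odd_caps; have [eoX eoY eoZ] := odd_stretches.
have sX2 := pHall_sub sX; have sY2 := pHall_sub sY.
have ti : X2 :&: Y2 = 1.
  apply/trivgP/subsetP => x /setIP[xX xY]; apply/set1P; apply/eqP.
  have xXY : x \in X :&: Y by rewrite inE (subsetP sX2) // (subsetP sY2).
  rewrite -order_eq1 -dvdn1 -(part_p'nat (pi := 2%N) (n := #|X :&: Y|)); last first.
    by rewrite -odd_2'nat.
  have x2 : 2.-elt x by exact: mem_p_elt (pHall_pgroup sX) xX.
  by rewrite -(part_pnat_id x2) partn_dvd ?cardG_gt0 ?order_dvdG.
have X2n1 : X2 <> 1%G.
  move=> X1; have := card_Hall sX; rewrite X1 cards1 => /esym/eqP.
  rewrite p_part -(expn0 2) eqn_exp2l // => /eqP l0.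
  by have := even_card; rewrite -(expn1 2) pfactor_dvdn ?cardG_gt0 // l0.
have cX2 : cyclic X2.
  apply: cyclic_unique_involution mulC _ (pHall_pgroup sX) _ => x y xX yX.
  by apply: unique_involution; exact: (subsetP sX2).
have sub2 (U P : {group gT}) : 2.-Sylow(U) P -> P \subset G2.
  move=> sU; rewrite (sub_normal_Hall sG) ?subsetT ?(pHall_pgroup sU) //.
  by rewrite /normal subsetT abelian_sub_norm.
split=> //; rewrite dprodE //; last first.
  by apply/centsP => x _ y _; exact: mulC.
apply/eqP; rewrite eqEcard mul_subG ?(sub2 _ _ sX) ?(sub2 _ _ sY) //=.
rewrite TI_cardMg // (card_Hall sX) (card_Hall sY) (card_Hall sG) cardsT.
have [cX cY _ cT] := card_parameters mulC cap1 full.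
have E : (#|X| * #|Y| * eZ = #|gT| * #|X :&: Y|)%N.
  by rewrite cX cY cT -/eX -/eY -/eZ; lia.
have := congr1 (partn^~ 2) E; rewrite !partnM ?muln_gt0 ?cardG_gt0 //; last 2 first.
- by rewrite -cardsT cardG_gt0.
- exact: indexg_gt0.
rewrite (part_p'nat (n := eZ)) -?odd_2'nat //.
by rewrite (part_p'nat (n := #|X :&: Y|)) -?odd_2'nat // !muln1 => ->.
Qed.
End NoTransversal.

(** * The exceptional triples have no common transversal *)

Section Obstruction.
Variable gT : finGroupType.
Hypothesis mulC : commutative (@mulg gT).
Implicit Types X Y Z P : {group gT}.

Lemma abelian_normal P X : P \subset X -> P <| X.
Proof. by move=> sPX; rewrite /normal sPX abelian_sub_norm. Qed.

Lemma involution_p_elt (x : gT) : x * x = 1 -> 2.-elt x.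
Proof.
move=> x2; have : (#[x] %| 2)%N by rewrite order_dvdn expgS expg1 x2.
by move=> d; apply: pnat_dvd d _.
Qed.

Lemma prod_transversal X (T : {set gT}) : transversal X T ->
  coset X (\prod_(t in T) t) = \prod_(q : coset_of X) q.
Proof.
move=> trT; rewrite (@prod_all_imset _ (coset_mulC mulC (E:=X)) _ T (coset X)).
- by rewrite (big_morph (coset X) (cosetM mulC X) (morph1 _)).
- move=> t t' tT t'T /eqP; rewrite eq_cosetE // => tt'.
  have [u [_ uni]] := trT t.
  by rewrite -(uni t) ?mulgV ?group1 // -(uni t').
- apply/setP=> q; rewrite inE -(coset_reprK q); apply/imsetP.
  have [t [[tT qt] _]] := trT (repr q); exists t => //; apply/eqP.
  by rewrite eq_cosetE.
Qed.

(** The involutions of the quotient are represented by elements of [G2 = X2 * P],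
    hence of [P], and the cyclic group [P] has a single one. *)
Lemma prod_quotient X (X2 P G2 : {group gT}) y :
    2.-Sylow(X) X2 -> 2.-Sylow([set: gT]) G2 -> X2 \x P = G2 -> cyclic P ->
    y \in P -> y * y = 1 -> y != 1 ->
  \prod_(q : coset_of X) q = coset X y.
Proof.
move=> sX sG /dprodP[_ mulG _ ti] cP yP y2 y1.
have pG := pHall_pgroup sG.
have memX2 u : u \in X -> 2.-elt u -> u \in X2.
  by move=> uX u2; rewrite (mem_normal_Hall sX) // abelian_normal // (pHall_sub sX).
have PX u : u \in P -> u \in X -> u = 1.
  move=> uP uX; apply/set1gP; rewrite -ti inE uP andbT memX2 //.
  apply: mem_p_elt pG _; rewrite -mulG; apply/mulsgP.
  by exists 1 u => //; rewrite mul1g.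
have uniP u : u \in P -> u * u = 1 -> u != 1 -> u = y.
  move=> uP u2 u1.
  have o2 v : v * v = 1 -> v != 1 -> #[v] = 2%N.
    by move=> v2 v1; apply: nt_prime_order => //; rewrite expgS expg1.
  have := cycle_id u.
  have /eqP -> : <[u]> == <[y]> :> {set gT}.
    by rewrite (eq_subG_cyclic cP) ?cycle_subG // -!orderE !o2.
  by rewrite cycle2g ?o2 // !inE (negPf u1) => /eqP.
apply: prod_all_of_unique_involution; first exact: coset_mulC.
- by rewrite -cosetM // y2 morph1.
- apply: contra y1 => /eqP yX; apply/eqP/PX => //.
  by apply: coset_idr => //; exact: abelian_mem_norm.
move=> q q2 q1.
have qE : q = coset X (repr q).`_2.
  rewrite morph_constt ?abelian_mem_norm //= coset_reprK.
  rewrite constt_p_elt //.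
  have : (#[q] %| 2)%N by rewrite order_dvdn expgS expg1 q2.
  by move=> d; apply: pnat_dvd d _.
have : (repr q).`_2 \in G2.
  rewrite (mem_normal_Hall sG) ?inE ?p_elt_constt //.
  by rewrite abelian_normal ?subsetT.
rewrite -mulG => /mulsgP[a b aX bP ab].
have {}qE : q = coset X b.
  by rewrite qE ab cosetM // coset_id ?mul1g // (subsetP (pHall_sub sX)).
rewrite qE; congr (coset X _); apply: uniP => //.
  apply: PX; first by rewrite groupM.
  apply: coset_idr; first exact: abelian_mem_norm.
  by rewrite cosetM // -qE.
by apply: contra q1 => /eqP b1; rewrite qE b1 morph1.
Qed.

Lemma cyclic_involution P : 2.-group P -> P <> 1%G ->
  exists2 y, y \in P & y * y = 1 /\ y != 1.
Proof.
move=> pP P1; have [|_ d2 _] := pgroup_pdiv pP.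
  by apply/eqP => E; apply: P1; apply/val_inj.
have [y yP oy] := Cauchy (isT : prime 2) d2.
exists y => //; split; last by rewrite -order_gt1 oy.
by rewrite -[RHS](expg_order y) oy expgS expg1.
Qed.

(** The product [s] of a common transversal would lie in [y X], [x Y] and [x Z], where
    [x] and [y] are the involutions of [X2] and [Y2]. *)
Lemma no_common_transversal_of_structure X Y Z (X2 Y2 Z2 G2 : {group gT}) :
    2.-Sylow(X) X2 -> 2.-Sylow(Y) Y2 -> 2.-Sylow(Z) Z2 -> 2.-Sylow([set: gT]) G2 ->
    X2 <> 1%G -> Y2 <> 1%G -> cyclic X2 -> cyclic Y2 ->
    X2 :&: Y2 = 1 -> Y2 :&: Z2 = 1 -> X2 \x Y2 = G2 -> X2 \x Z2 = G2 ->
  ~ common_transversal X Y Z.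
Proof.
move=> sX sY sZ sG X1 Y1 cX cY tXY tYZ dXY dXZ [T [tX tY tZ]].
have [x xX [x2 x1]] := cyclic_involution (pHall_pgroup sX) X1.
have [y yY [y2 y1]] := cyclic_involution (pHall_pgroup sY) Y1.
set s := \prod_(t in T) t.
have Es (U : {group gT}) V : transversal U T ->
  \prod_(q : coset_of U) q = coset U V -> s * V^-1 \in U.
  by move=> tU E; rewrite -eq_cosetE // prod_transversal // E.
have sX' := Es X y tX (prod_quotient sX sG dXY cY yY y2 y1).
have sY' := Es Y x tY (prod_quotient sY sG (etrans (dprodC _ _) dXY) cX xX x2 x1).
have sZ' := Es Z x tZ (prod_quotient sZ sG (etrans (dprodC _ _) dXZ) cX xX x2 x1).
have memS (U U2 : {group gT}) u : 2.-Sylow(U) U2 -> u \in U -> u * u = 1 -> u \in U2.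
  move=> sU uU u2; rewrite (mem_normal_Hall sU) ?involution_p_elt //.
  by rewrite abelian_normal // (pHall_sub sU).
have xX1 := subsetP (pHall_sub sX) _ xX; have yY1 := subsetP (pHall_sub sY) _ yY.
pose c := s * x^-1 * y^-1.
have cXY : c \in X :&: Y.
  apply/setIP; split; last by rewrite groupM ?groupV.
  by rewrite /c -mulgA [x^-1 * _]mulC mulgA groupM ?groupV.
have oddXY : odd #|X :&: Y|.
  apply/negPn/negP; rewrite -dvdn2 => d2.
  have [z /setIP[zX zY] oz] := Cauchy (isT : prime 2) d2.
  have z2 : z * z = 1 by rewrite -[RHS](expg_order z) oz expgS expg1.
  have : z \in X2 :&: Y2 by rewrite inE (memS X) // (memS Y).
  by rewrite tXY => /set1gP z1; move: oz; rewrite z1 order1.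
have cyZ : c * y \in Z by rewrite /c mulgKV.
have yZ : y \in Z.
  have := groupX #|X :&: Y| cyZ.
  rewrite expgMn; last exact: mulC.
  rewrite (expg_cardG cXY) mul1g -(odd_double_half #|X :&: Y|) oddXY.
  by rewrite expgD expg1 -muln2 mulnC expgM [y ^+ 2]y2 expg1n mulg1.
have : y \in Y2 :&: Z2 by rewrite inE yY (memS Z).
by rewrite tYZ => /set1gP y1'; rewrite y1' eqxx in y1.
Qed.

End Obstruction.

(** * From lattices to the finite quotient *)

Import Order.TTheory GRing.Theory Num.Theory.

Section Quotient.
Local Open Scope ring_scope.
Local Open Scope quotient_scope.
Variables (R : realType) (d : nat) (K L M : lattice R d).
Variable h : is_lattice (lattice_sum3 K L M).
Notation G := (sum3_mod_cap3 h).
Implicit Types (u v : sum3_type K L M) (N : lattice R d).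

Lemma pi_eq u v : (\pi_G u == \pi_G v) = (val (u - v) \in lattice_cap3 K L M).
Proof. by rewrite -Quotient.idealrBE. Qed.

Lemma piD u v : \pi_G (u + v) = (\pi_G u * \pi_G v)%g.
Proof. exact: (@pi_addr _ _ _ _ _ G). Qed.

Lemma piN u : \pi_G (- u) = (\pi_G u)^-1%g.
Proof. exact: (@pi_oppr _ _ _ _ _ G). Qed.

Lemma pi0 : \pi_G 0 = 1%g.
Proof. exact: (@pi_zeror _ _ _ _ _ G). Qed.

Lemma sum3_mod_cap3_mulC : commutative (@mulg G).
Proof. by move=> x y; exact: GRing.addrC. Qed.

Lemma mem_lattice_mod_cap3 N u : {subset lattice_cap3 K L M <= N} ->
  (\pi_G u \in lattice_mod_cap3 h N) = (val u \in N).
Proof.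
move=> sHN; apply/lattice_mod_cap3P/idP => [[v vN]|uN]; last by exists u.
move/eqP; rewrite pi_eq => /sHN uv.
by rewrite -(subrK v u) rpredD.
Qed.

Lemma cap3_subK : {subset lattice_cap3 K L M <= K}.
Proof. by move=> v /and3P[]. Qed.
Lemma cap3_subL : {subset lattice_cap3 K L M <= L}.
Proof. by move=> v /and3P[]. Qed.
Lemma cap3_subM : {subset lattice_cap3 K L M <= M}.
Proof. by move=> v /and3P[]. Qed.

Lemma subK_sum3 : {subset K <= lattice_sum3 K L M}.
Proof.
by move=> v vK; apply/asboolP; exists v, 0, 0; rewrite !rpred0 !addr0.
Qed.
Lemma subL_sum3 : {subset L <= lattice_sum3 K L M}.
Proof.
by move=> v vL; apply/asboolP; exists 0, v, 0; rewrite !rpred0 addr0 add0r.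
Qed.
Lemma subM_sum3 : {subset M <= lattice_sum3 K L M}.
Proof.
by move=> v vL; apply/asboolP; exists 0, 0, v; rewrite !rpred0 !add0r.
Qed.

Local Notation X := (lattice_mod_cap3_group h K).
Local Notation Y := (lattice_mod_cap3_group h L).
Local Notation Z := (lattice_mod_cap3_group h M).

Lemma quotient_caps : (X :&: Y :&: Z = 1)%g.
Proof.
apply/trivgP/subsetP => x /setIP[/setIP[xX xY] xZ].
apply/set1gP; move: xX xY xZ; rewrite -[x]reprK.
rewrite !mem_lattice_mod_cap3; [|exact: cap3_subM|exact: cap3_subL|exact: cap3_subK].
move=> uK uL uM; rewrite -pi0; apply/eqP; rewrite pi_eq subr0.
by apply/and3P.
Qed.

Lemma quotient_span : (X <*> (Y <*> Z) = [set: G])%g.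
Proof.
apply/setP=> x; rewrite inE -[x]reprK; move: (generic_quotient.repr x) => u {x}.
have /asboolP[a [b [c [aK bL cM uE]]]] := valP u.
have -> : \pi_G u = (\pi_G (Sum3 (subK_sum3 aK)) *
    (\pi_G (Sum3 (subL_sum3 bL)) * \pi_G (Sum3 (subM_sum3 cM))))%g.
  rewrite -!piD; congr (\pi_G _); apply: val_inj.
  by rewrite !raddfD /= addrA.
apply/joingPC; first exact: sum3_mod_cap3_mulC.
exists (\pi_G (Sum3 (subK_sum3 aK))).
  by rewrite mem_lattice_mod_cap3 //; exact: cap3_subK.
exists (\pi_G (Sum3 (subL_sum3 bL)) * \pi_G (Sum3 (subM_sum3 cM)))%g => //.
apply/joingPC; first exact: sum3_mod_cap3_mulC.
exists (\pi_G (Sum3 (subL_sum3 bL))).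
  by rewrite mem_lattice_mod_cap3 //; exact: cap3_subL.
exists (\pi_G (Sum3 (subM_sum3 cM))) => //.
by rewrite mem_lattice_mod_cap3 //; exact: cap3_subM.
Qed.

Section Domains.
Variable N : lattice R d.
Hypotheses (sHN : {subset lattice_cap3 K L M <= N})
  (sNS : {subset N <= lattice_sum3 K L M}).

Definition quotient_trace (F : set 'cV[R]_d) : {set G} :=
  [set x : G | `[< exists2 u, F (val u) & x = \pi_G u >]].

Lemma transversal_quotient_trace (F : set 'cV[R]_d) : fundamental_domain N F ->
  transversal (lattice_mod_cap3 h N) (quotient_trace F).
Proof.
move=> fdF g; rewrite -[g]reprK; move: (generic_quotient.repr g) => u {g}.
have [f [[Ff uf] uniF]] := fdF (val u).
have fS : f \in lattice_sum3 K L M.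
  by rewrite -(subKr (val u) f); apply: rpredB (valP u) (sNS uf).
exists (\pi_G (Sum3 fS)); split; first split.
- by rewrite inE; apply/asboolP; exists (Sum3 fS).
- by rewrite -piN -piD mem_lattice_mod_cap3 // raddfB.
move=> t []; rewrite inE => /asboolP[w Fw ->].
rewrite -piN -piD mem_lattice_mod_cap3 // raddfB => uw.
by congr (\pi_G _); apply: val_inj; exact: uniF.
Qed.

(** A choice of representatives modulo [K + L + M], depending on the coset only. *)
Definition sum3_rep (v : 'cV[R]_d) : 'cV[R]_d :=
  xget 0 [set w | v - w \in lattice_sum3 K L M].

Lemma sum3_repP (v : 'cV[R]_d) : v - sum3_rep v \in lattice_sum3 K L M.
Proof.
rewrite /sum3_rep; case: xgetP => [w _ //|/(_ v)] /=.
by rewrite subrr rpred0.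
Qed.

Lemma sum3_rep_eq (v w : 'cV[R]_d) :
  v - w \in lattice_sum3 K L M -> sum3_rep v = sum3_rep w.
Proof.
move=> vw; congr (xget 0 _); apply/seteqP; split=> z /= H.
  have -> : w - z = - (v - w) + (v - z) by rewrite opprB addrA subrK.
  by rewrite rpredD // rpredN.
have -> : v - z = (v - w) + (w - z) by rewrite addrA subrK.
exact: rpredD.
Qed.

Definition quotient_lift (T : {set G}) : set 'cV[R]_d :=
  [set w | exists2 t, t \in T & w = sum3_rep w + val (generic_quotient.repr t)].

Lemma fundamental_domain_lift (T : {set G}) :
  transversal (lattice_mod_cap3 h N) T -> fundamental_domain N (quotient_lift T).
Proof.
move=> trT v; pose u : sum3_type K L M := Sum3 (sum3_repP v).
have vE : v = sum3_rep v + val u by rewrite /= addrC subrK.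
have [t [[tT ut] uniT]] := trT (\pi_G u).
pose f := sum3_rep v + val (generic_quotient.repr t).
have vf : v - f = val (u - generic_quotient.repr t).
  by rewrite raddfB /= /f opprD addrA.
have memN s : ((\pi_G u * s^-1)%g \in lattice_mod_cap3 h N) =
    (val (u - generic_quotient.repr s) \in N).
  by rewrite -{1}[s]reprK -piN -piD mem_lattice_mod_cap3.
have vfN : v - f \in N by rewrite vf -memN.
exists f; split; first split=> //.
  by exists t => //; rewrite {1}/f; congr (_ + _); apply: sum3_rep_eq; exact: sNS.
move=> f' [[t' t'T f'E] vf'].
have rE : sum3_rep f' = sum3_rep v by apply/esym/sum3_rep_eq/sNS.
rewrite f'E rE /f; congr (_ + val (generic_quotient.repr _)).
apply: uniT; split=> //; rewrite memN.
by rewrite raddfB /= -addrA -opprD -rE -f'E.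
Qed.
End Domains.

Lemma common_transversal_domain : common_transversal X Y Z <->
  exists F, [/\ fundamental_domain K F, fundamental_domain L F
              & fundamental_domain M F].
Proof.
split=> [[T [tX tY tZ]]|[F [fK fL fM]]].
  exists (quotient_lift T); split; apply: fundamental_domain_lift => //.
  - exact: cap3_subK.
  - exact: subK_sum3.
  - exact: cap3_subL.
  - exact: subL_sum3.
  - exact: cap3_subM.
  - exact: subM_sum3.
exists (quotient_trace F); split; apply: transversal_quotient_trace => //.
- exact: cap3_subK.
- exact: subK_sum3.
- exact: cap3_subL.
- exact: subL_sum3.
- exact: cap3_subM.
- exact: subM_sum3.
Qed.
End Quotient.

(** * The index of a lattice and its volume *)

Section Index.
Local Open Scope ring_scope.
Local Open Scope quotient_scope.

Lemma absz_det_unitmx (n : nat) (A : 'M[int]_n) : A \in unitmx -> `|\det A|%N = 1%N.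
Proof.
move=> uA; have := congr1 (fun B : 'M[int]_n => `|\det B|%N) (mulmxV uA).
rewrite det_mulmx det1 abszM absz1 => /eqP.
by rewrite muln_eq1 => /andP[/eqP].
Qed.

Variables (R : realType) (d : nat) (K L M N B : lattice R d).
Variable h : is_lattice (lattice_sum3 K L M).
Notation G := (sum3_mod_cap3 h).
Hypotheses (sHN : {subset lattice_cap3 K L M <= N})
  (sNS : {subset N <= lattice_sum3 K L M})
  (SB : lattice_sum3 K L M =i B).
Let P := lattice_basis B.
Let A := lattice_basis N.

Lemma basis_coordinates : exists U : 'M[int]_d, A = P *m map_mx intr U.
Proof.
have colA j : exists z : 'cV[int]_d, col j A = P *m map_mx intr z.
  apply/asboolP; rewrite -[`[< _ >]]/(col j A \in B) -SB; apply: sNS.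
  by apply/asboolP; exists (delta_mx j 0); rewrite -/A map_delta_mx colE.
have [z Ez] := choice colA.
exists (\matrix_(i, j) z j i 0); apply/matrixP=> i j.
have /matrixP/(_ i 0) := Ez j; rewrite !mxE => ->.
by apply: eq_bigr => k _; rewrite !mxE.
Qed.

(** In a basis [P] of [K + L + M] adapted to the Smith form [Ls * diag ds * Rs] of
    the coordinate matrix [U] of [N], the boxes with sides [`|ds`_i|] provide one
    point of each coset; their number is [`|\det U|]. *)
Lemma index_volume :
  volume N = volume B * (#|[set: G]%g : lattice_mod_cap3_group h N|%g)%:R.
Proof.
have uP : P \in unitmx by exact: lattice_basis_unit.
have uA : A \in unitmx by exact: lattice_basis_unit.
have [U AU] := basis_coordinates.
have detU : \det A = \det P * (\det U)%:~R by rewrite AU det_mulmx det_map_mx.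
have U0 : \det U != 0.
  by apply: contraTneq uA => U0; rewrite unitmxE detU U0 mulr0 unitr0.
suff cardX : #|[set: G]%g : lattice_mod_cap3_group h N|%g = `|\det U|%N.
  rewrite /volume -/A -/P detU normrM cardX; congr (_ * _).
  by rewrite -intr_norm -abszE.
have [Ls uL [Rs uR [ds _ UE]]] := int_Smith_normal_form U.
have dgE : \matrix_(i, j) (ds`_i *+ (i == j :> nat)) = diag_mx (\row_(i < d) ds`_i).
  by apply/matrixP => i j; rewrite !mxE.
rewrite {}dgE in UE.
pose r (i : 'I_d) : int := ds`_i.
pose e (i : 'I_d) : nat := `|r i|%N.
have detUE : `|\det U|%N = (\prod_(i < d) e i)%N.
  rewrite UE !det_mulmx !abszM (absz_det_unitmx uL) (absz_det_unitmx uR).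
  rewrite mul1n muln1 det_diag (big_morph absz abszM absz1).
  by apply: eq_bigr => i _; rewrite mxE.
have e0 (i : 'I_d) : (0 < e i)%N.
  move: U0; rewrite -absz_gt0 detUE (bigD1 i) //= muln_gt0.
  by case/andP.
have ds0 (i : 'I_d) : ds`_i != 0 by rewrite -absz_gt0; exact: e0.
(* [Ls *m z f] runs, for [f] in [J], through the box: modulo [U] the coordinates in
   the basis [P *m Ls] only matter modulo the elementary divisors. *)
pose J := {dffun forall i : 'I_d, 'I_(e i)}.
have cardJ : #|J| = `|\det U|%N.
  rewrite card_dep_ffun detUE foldrE big_image /=.
  by apply: eq_bigr => i _; rewrite card_ord.
have memN (x : 'cV[int]_d) :
    P *m map_mx intr x \in N <-> exists z, x = U *m z.
  split=> [/asboolP[z]|[z ->]].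
    rewrite -/A AU -mulmxA -map_mxM => /(can_inj (mulKmx uP)) E.
    exists z; apply/matrixP => i j; move/matrixP/(_ i j): E.
    by rewrite [LHS]mxE [RHS]mxE => /intr_inj.
  by apply/asboolP; exists z; rewrite -/A AU -mulmxA -map_mxM.
pose pt (z : 'cV[int]_d) : sum3_type K L M := insubd 0 (P *m map_mx intr z).
have ptE z : val (pt z) = P *m map_mx intr z.
  rewrite insubdK //; change (P *m map_mx intr z \in lattice_sum3 K L M).
  by rewrite SB; apply/asboolP; exists z.
pose X := lattice_mod_cap3_group h N.
pose c (z : 'cV[int]_d) := coset X (\pi_G (pt z)).
have cE x y : c x = c y <-> exists z, x - y = U *m z.
  rewrite -memN /c; split=> [/eqP|xy].
    rewrite eq_cosetE; last exact: sum3_mod_cap3_mulC.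
    rewrite -piN -piD mem_lattice_mod_cap3 // raddfB /=.
    rewrite !(ptE : forall z, sum3_val (pt z) = _).
    by rewrite -mulmxBr -map_mxB.
  apply/eqP; rewrite eq_cosetE; last exact: sum3_mod_cap3_mulC.
  rewrite -piN -piD mem_lattice_mod_cap3 // raddfB /=.
  rewrite !(ptE : forall z, sum3_val (pt z) = _).
  by rewrite -mulmxBr -map_mxB.
pose z (f : J) : 'cV[int]_d := \col_i (f i : nat)%:Z.
have [f_inj f_onto] : injective (fun f => c (Ls *m z f)) /\
    forall q, exists f, q = c (Ls *m z f).
  split=> [f g /cE[y E]|q].
    have {}E : z f - z g = diag_mx (\row_(i < d) ds`_i) *m (Rs *m y).
      apply: (can_inj (mulKmx uL)).
      by rewrite mulmxBr E UE -!mulmxA.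
    apply/ffunP => i; apply/val_inj => /=.
    move: (Rs *m y) E => w /matrixP/(_ i 0).
    rewrite mul_diag_mx !mxE -/(r i); move: (w i ord0) => k E.
    have fi : (f i < `|r i|)%N := ltn_ord (f i).
    have gi : (g i < `|r i|)%N := ltn_ord (g i).
    have [w0|w0] := eqVneq k 0.
      by move: E; rewrite w0 mulr0 => /eqP; rewrite subr_eq0 => /eqP[].
    have w1 : (0 < `|k|)%N by rewrite absz_gt0.
    have := congr1 absz E; rewrite abszM => E'.
    have : (`|r i| <= `|r i| * `|k|)%N by rewrite leq_pmulr.
    by rewrite -E'; lia.
  have [x qE] : exists x, q = c x.
    have [u ->] : exists u, q = coset X (\pi_G u).
      by exists (generic_quotient.repr (repr q)); rewrite reprK coset_reprK.
    have /asboolP[x uE] : val u \in B by rewrite -SB; exact: valP.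
    by exists x; rewrite /c; congr (coset X (\pi_G _)); apply: val_inj; rewrite ptE.
  have [x' xE] : exists x', x = Ls *m x' by exists (invmx Ls *m x); rewrite mulKVmx.
  pose y i := x' i ord0.
  have bound i : (`|(y i %% r i)%Z| < e i)%N.
    rewrite -ltz_nat gez0_abs ?modz_ge0 ?ds0 //.
    by rewrite /e; exact: ltz_mod (ds0 i).
  exists [ffun i => Ordinal (bound i)]; rewrite qE; apply/cE.
  exists (invmx Rs *m \col_i (y i %/ r i)%Z).
  rewrite UE -!mulmxA (mulKVmx uR) xE -mulmxBr.
  congr (Ls *m _); rewrite mul_diag_mx; apply/matrixP => i j.
  rewrite !mxE !ffunE /= -/(r i) !ord1 gez0_abs ?modz_ge0 ?ds0 //.
  by rewrite -/(y i) {1}(divz_eq (y i) (r i)) addrK mulrC.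
rewrite -card_quotient ?abelian_sub_norm //; last exact: sum3_mod_cap3_mulC.
rewrite quotient_setT; last exact: sum3_mod_cap3_mulC.
rewrite cardsT -cardJ; apply/esym/(bij_eq_card (f := fun f => c (Ls *m z f))).
apply: (inj_card_bij f_inj); rewrite -(card_codom f_inj).
apply: subset_leq_card; apply/subsetP => q _.
by have [f ->] := f_onto q; exact: codom_f.
Qed.
End Index.

(** * Common fundamental domains of three lattices *)

Section Size.
Local Open Scope ring_scope.
Variables (R : realType) (d : nat) (K L M : lattice R d).
Variable h : is_lattice (lattice_sum3 K L M).

Lemma card_lattice_mod_cap3 (N N' : lattice R d) :
    {subset lattice_cap3 K L M <= N} -> {subset N <= lattice_sum3 K L M} ->
    {subset lattice_cap3 K L M <= N'} -> {subset N' <= lattice_sum3 K L M} ->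
    volume N = volume N' ->
  #|lattice_mod_cap3 h N| = #|lattice_mod_cap3 h N'|.
Proof.
move=> sHN sNS sHN' sNS'; have [B SB] := h.
rewrite (index_volume h sHN sNS SB) (index_volume h sHN' sNS' SB).
have B0 : volume B != 0.
  by rewrite normr_eq0 -unitfE -unitmxE; exact: lattice_basis_unit.
move/(mulfI B0)/eqP; rewrite eqr_nat => /eqP E.
pose X N0 := lattice_mod_cap3_group h N0.
have i0 : (0 < #|[set: sum3_mod_cap3 h]%g : X N|%g)%N by exact: indexg_gt0.
apply/eqP; rewrite -(eqn_pmul2r i0) {2}E.
have LX N0 := Lagrange (subsetT (X N0)).
by rewrite (LX N) (LX N').
Qed.
End Size.

Theorem theorem2 (R : realType) (d : nat) (K L M : lattice R d)
    (volKL : volume K = volume L) (volLM : volume L = volume M)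
    (sum_lat : is_lattice (lattice_sum3 K L M))
    (X2 Y2 Z2 G2 : {group sum3_mod_cap3 sum_lat})
    (sylX : (2.-Sylow(lattice_mod_cap3 sum_lat K) X2)%g)
    (sylY : (2.-Sylow(lattice_mod_cap3 sum_lat L) Y2)%g)
    (sylZ : (2.-Sylow(lattice_mod_cap3 sum_lat M) Z2)%g)
    (sylG : (2.-Sylow([set: sum3_mod_cap3 sum_lat]) G2)%g) :
  ~ (exists F : set 'cV[R]_d,
       [/\ fundamental_domain K F, fundamental_domain L F
         & fundamental_domain M F])
  <->
  [/\ [/\ X2 <> 1%G, Y2 <> 1%G & Z2 <> 1%G],
      [/\ cyclic X2, cyclic Y2 & cyclic Z2],
      [/\ (X2 :&: Y2 = 1)%g, (X2 :&: Z2 = 1)%g & (Y2 :&: Z2 = 1)%g]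
    & [/\ (X2 \x Y2 = G2)%g, (X2 \x Z2 = G2)%g & (Y2 \x Z2 = G2)%g]].
Proof.
have mulC := sum3_mod_cap3_mulC (h := sum_lat).
pose X := lattice_mod_cap3_group sum_lat K.
pose Y := lattice_mod_cap3_group sum_lat L.
pose Z := lattice_mod_cap3_group sum_lat M.
have sHK := @cap3_subK R d K L M; have sHL := @cap3_subL R d K L M.
have sHM := @cap3_subM R d K L M; have sKS := @subK_sum3 R d K L M.
have sLS := @subL_sum3 R d K L M; have sMS := @subM_sum3 R d K L M.
have XY : #|X| = #|Y| by exact: card_lattice_mod_cap3.
have YZ : #|Y| = #|Z| by exact: card_lattice_mod_cap3.
have cap1 := quotient_caps sum_lat; have full := quotient_span sum_lat.
have domE := common_transversal_domain sum_lat.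
split=> [noF|[[X1 Y1 Z1] [cX cY cZ] [tXY tXZ tYZ] [dXY dXZ dYZ]] /domE]; last first.
  exact: (no_common_transversal_of_structure mulC (X := X) (Y := Y) (Z := Z)
    sylX sylY sylZ sylG).
have nct : ~ common_transversal X Y Z by move/domE.
have [X1 cX tXY dXY] := no_transversal_structure mulC cap1 full XY (etrans XY YZ)
  nct sylX sylY sylG.
have [Y1 cY tYZ dYZ] : [/\ Y2 <> 1%G, cyclic Y2, (Y2 :&: Z2 = 1)%g & (Y2 \x Z2 = G2)%g].
  apply: (no_transversal_structure mulC (X := Y) (Y := Z) (Z := X)) => //.
  - by rewrite setIC setIA.
  - by rewrite -full [in RHS]joingC -joingA.
  - by move=> ct; apply: nct; apply/common_transversal12/common_transversal23.
have [Z1 cZ tZX dZX] : [/\ Z2 <> 1%G, cyclic Z2, (Z2 :&: X2 = 1)%g & (Z2 \x X2 = G2)%g].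
  apply: (no_transversal_structure mulC (X := Z) (Y := X) (Z := Y)) => //.
  - by rewrite -setIA setIC.
  - by rewrite -full [in RHS]joingA [in RHS]joingC.
  - by rewrite -YZ.
  - by move=> ct; apply: nct; apply/common_transversal23/common_transversal12.
by split; split=> //; rewrite ?(setIC X2 Z2) ?(dprodC X2 Z2).
Qed.
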